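(* For each bounded, linear projection $P$ on $C_0[0,\omega_1)$, either the kernel of $P$ is isomorphic to $C_0[0,\omega_1)$ and the range of $P$ embeds in $C_0(L_0)$, or vice versa (that is, the range of $P$ is isomorphic to $C_0[0,\omega_1)$ and the kernel of $P$ embeds in $C_0(L_0)$).
   Context: Scalars are in $\mathbb{K}=\mathbb{R}$ or $\mathbb{K}=\mathbb{C}$. $\omega_1$ is the first uncountable ordinal; ordinal intervals carry the order topology. For a locally compact Hausdorff space $L$, $C_0(L)$ is the Banach space (supremum norm) of continuous scalar-valued functions on $L$ vanishing at infinity; $C_0[0,\omega_1)$ consists of the continuous functions on $[0,\omega_1)$ that vanish eventually. $L_0=\bigcup_{\alpha<\omega_1}[0,\alpha]\times\{\alpha+1\}$, a locally compact Hausdorff space in the topology inherited from the product topology on $[0,\omega_1)^2$. Isomorphic means linearly homeomorphic; $X$ embeds in $Y$ if $X$ is isomorphic to a closed subspace of $Y$. *)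

(* Defs.v *)
From HB Require Import structures.
From mathcomp Require Import all_boot all_order all_algebra.
From mathcomp Require Import all_classical all_reals all_analysis.
From mathcomp Require wochoice.
From mathcomp Require Export complex.

Set Implicit Arguments.
Unset Strict Implicit.
Unset Printing Implicit Defensive.

Import Order.TTheory GRing.Theory Num.Theory.
Import numFieldNormedType.Exports.

Local Open Scope classical_set_scope.
Local Open Scope ring_scope.

Section C0.
Context (K : numFieldType) (L : topologicalType).
Implicit Types f g : L -> K^o.

Definition vanishes_at_infinity f :=
  forall e : K, 0 < e -> compact [set x | e <= `|f x|].

Definition isC0 : {pred L -> K^o} :=
  [pred f | `[< continuous f /\ vanishes_at_infinity f >]].

Lemma isC0P f : reflect (continuous f /\ vanishes_at_infinity f) (f \in isC0).
Proof. exact: asboolP. Qed.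

Let ltNnorm (a e : K) : 0 < e -> (e <= `|a|) = ~~ (`|a| < e).
Proof. by move=> e0; rewrite real_ltNge ?negbK ?normr_real ?gtr0_real. Qed.

Let open_norm_lt f (e : K) : continuous f -> open [set x | `|f x| < e].
Proof.
by move=> cf; rewrite openE => x /= fx; exact: (cvgr_norm_lt (f x) (cf x)).
Qed.

Let compact_sub f (e : K) (C : set L) : 0 < e -> continuous f ->
  compact C -> [set x | e <= `|f x|] `<=` C -> compact [set x | e <= `|f x|].
Proof.
move=> e0 cf cC; apply: subclosed_compact => //.
rewrite (_ : [set x | _] = ~` [set x | `|f x| < e]).
  by apply: open_closedC; exact: open_norm_lt.
by apply/seteqP; split => x /=; rewrite ltNnorm// => /negP.
Qed.

Lemma isC0_submod : submod_closed isC0.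
Proof.
split=> [|a f g /isC0P[cf vf] /isC0P[cg vg]]; apply/isC0P; split.
- by move=> x; exact: cvg_cst.
- move=> e e0; rewrite (_ : [set x | _] = set0); first exact: compact0.
  by apply/seteqP; split => x //=; rewrite normr0 lt_geF.
- by move=> x; apply: cvgD; [apply: cvgZr; exact: cf|exact: cg].
- move=> e e0.
  have c : continuous (a *: f + g).
    by move=> x; apply: cvgD; [apply: cvgZr; exact: cf|exact: cg].
  pose d := e / 2%:R / (1 + `|a|).
  have a0 : 0 < 1 + `|a| by rewrite ltr_pwDl.
  have e20 : 0 < e / 2%:R by rewrite divr_gt0.
  have d0 : 0 < d by rewrite !divr_gt0.
  apply: (compact_sub e0 c (compactU (vf _ d0) (vg _ e20))) => x /= ex.
  apply: contrapT => /not_orP[/negP + /negP].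
  rewrite !ltNnorm// !negbK => fd gd; move: ex; apply/negP.
  rewrite ltNnorm// negbK (le_lt_trans (ler_normD _ _))//.
  rewrite [ltRHS](splitr e) ler_ltD// normrM.
  rewrite (le_trans (ler_wpM2l (normr_ge0 a) (ltW fd)))//.
  rewrite /d mulrCA ler_piMr ?(ltW e20)// ler_pdivrMr// mul1r.
  by rewrite lerDr.
Qed.

HB.instance Definition _ := GRing.isSubmodClosed.Build K (L -> K^o) isC0
  isC0_submod.

Record C0 := MkC0 { C0_fun :> L -> K^o ; C0P : C0_fun \in isC0 }.

HB.instance Definition _ := [isSub for C0_fun].
HB.instance Definition _ := [Choice of C0 by <:].
HB.instance Definition _ := [SubChoice_isSubLmodule of C0 by <:].

(* The supremum is taken in K, whose order is partial when K is complex. It is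
   a genuine least upper bound, attained when L is not empty, for every K: see
   sup_norm_isLub below. *)
Definition sup_norm (f : C0) : K := supremum 0 (range (fun x => `|f x|)).

End C0.

Section C0_norm.
Context (K : numFieldType) (L : topologicalType).
Implicit Types f g : C0 K L.

Lemma C0_continuous f : continuous f.
Proof. by case: f => f /= /isC0P[]. Qed.

Let norm_leNgt f (x y : L) : (`|f x| <= `|f y|) = ~~ (`|f y| < `|f x|).
Proof. by rewrite real_leNgt ?normr_real. Qed.

Lemma C0_norm_attained f (x0 : L) : exists y, forall x, `|f x| <= `|f y|.
Proof.
have [[y0 fy0]|] := pselect (exists y, f y != 0); last first.
  move=> /forallNP f0; exists x0 => x.
  by have /negP := f0 x; rewrite negbK => /eqP ->; rewrite normr0.
have e0 : 0 < `|f y0| by rewrite normr_gt0.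
have [cf vf] := elimT (isC0P _) (C0P f).
have := vf _ e0; set C := [set x | _] => /compact_near_coveringP cC.
apply: contrapT => /forallNP nmax.
have {}nmax y : exists x, `|f y| < `|f x|.
  have /existsNP[x /negP] := nmax y.
  by rewrite norm_leNgt negbK; exists x.
pose F : set_system L :=
  [set A | exists x, [set z | `|f x| <= `|f z|] `<=` A].
have FF : Filter F.
  split; first by exists y0.
    move=> A B [x xA] [y yB]; have [xy|] := boolP (`|f x| <= `|f y|).
      by exists y => z /= yz; split; [apply/xA/(le_trans xy)|exact: yB].
    rewrite norm_leNgt negbK => /ltW yx.
    by exists x => z /= xz; split; [exact: xA|apply/yB/(le_trans yx)].
  by move=> A B AB [x xA]; exists x => z /xA /AB.
have [|x xC] := cC L F (fun z y => `|f y| < `|f z|) FF.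
- move=> y _; have [x yx] := nmax y.
  exists ([set y' | `|f y'| < `|f x|], [set z | `|f x| <= `|f z|]) => /=.
    split; last by exists x.
    exact: (cvgr_norm_lt (f y) (cf y)).
  by move=> [y' z] /= [h1 h2]; exact: lt_le_trans h2.
- have /= h := xC x (lexx _).
  have /h : C x by rewrite /C /= ltW//; apply: h; exact: lexx.
  by rewrite ltxx.
Qed.

Lemma sup_norm_isLub f : [set: L] !=set0 ->
  isLub (range (fun x => `|f x|)) (sup_norm f).
Proof.
move=> [x0 _]; have [y fy] := C0_norm_attained f x0.
have fyP : supremums (range (fun x => `|f x|)) `|f y|.
  by split=> [_ [x _ <-]//|M]; apply; exists y.
rewrite /sup_norm /supremum ifF.
  by case: xgetP => [z -> [zub zlub]|/(_ _ fyP)//]; split=> // b /zlub.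
by apply/negP => /eqP; apply/eqP/set0P; exists `|f x0|, x0.
Qed.

Lemma sup_norm_empty f : [set: L] = set0 -> sup_norm f = 0.
Proof. by move=> L0; rewrite /sup_norm L0 image_set0 supremum0. Qed.

Lemma sup_norm_ub f (x : L) : `|f x| <= sup_norm f.
Proof. by have [|+ _] := @sup_norm_isLub f; [exists x|apply; exists x]. Qed.

Lemma sup_norm_le f (M : K) :
  0 <= M -> (forall x, `|f x| <= M) -> sup_norm f <= M.
Proof.
move=> M0 fM; have [/sup_norm_empty ->//|/set0P L0] := eqVneq [set: L] set0.
by have [_] := sup_norm_isLub f L0; apply=> _ [x _ <-].
Qed.

Lemma sup_norm_ge0 f : 0 <= sup_norm f.
Proof.
have [/sup_norm_empty ->//|/set0P[x _]] := eqVneq [set: L] set0.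
exact: le_trans (sup_norm_ub f x).
Qed.

Let sup_normD f g : sup_norm (f + g) <= sup_norm f + sup_norm g.
Proof.
apply: sup_norm_le => [|x]; first by rewrite addr_ge0 ?sup_norm_ge0.
by rewrite (le_trans (ler_normD _ _))// lerD ?sup_norm_ub.
Qed.

Let sup_normZ (a : K) f : sup_norm (a *: f) = `|a| * sup_norm f.
Proof.
have le (b : K) (h : C0 K L) : sup_norm (b *: h) <= `|b| * sup_norm h.
  apply: sup_norm_le => [|x]; first by rewrite mulr_ge0 ?sup_norm_ge0.
  by rewrite normrM ler_wpM2l ?sup_norm_ub.
apply/eqP; rewrite eq_le le /=; have [->|a0] := eqVneq a 0.
  by rewrite normr0 mul0r sup_norm_ge0.
rewrite -ler_pdivlMl ?normr_gt0// -normfV.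
by rewrite -[leLHS]/(sup_norm f) -{1}(scalerK a0 f) le.
Qed.

Let sup_norm_eq0 f : sup_norm f = 0 -> f = 0.
Proof.
move=> f0; apply: val_inj; apply/funext => x /=.
by apply/eqP; rewrite -normr_le0 -f0 sup_norm_ub.
Qed.

HB.instance Definition _ :=
  Lmodule_isNormed.Build K (C0 K L) sup_normD sup_normZ sup_norm_eq0.

Lemma C0_normE f : `|f| = sup_norm f.
Proof. by []. Qed.

End C0_norm.

Section isomorphism.
Context (K : numFieldType).
Implicit Types V W : normedModType K.

Definition linear_on V W (A : set V) (T : V -> W) :=
  forall (a : K) x y, A x -> A y -> T (a *: x + y) = a *: T x + T y.

(* The values of T off A and of S off B are irrelevant. *)
Definition isomorphic V W (A : set V) (B : set W) :=
  exists (T : V -> W) (S : W -> V),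
    [/\ set_fun A B T, set_fun B A S,
        {in A, cancel T S}, {in B, cancel S T} &
     [/\ linear_on A T,
        {within A, continuous T} & {within B, continuous S}]].

Definition embeds V W (A : set V) :=
  exists B : set W, [/\ closed B, submod_closed [in B] & isomorphic A B].

End isomorphism.
Arguments embeds {K V} W A.

(* W has order type omega_1: it is an uncountable well-order all of whose proper
   initial segments are countable. *)
Definition is_omega1 d (W : orderType d) :=
  [/\ wochoice.well_order (<=%O : rel W),
      forall a : W, countable [set x | (x < a)%O]
    & ~ countable [set: W]].

Section omega1_existence.
Let T := {classic (nat -> Prop)}.

Let T_uncountable : ~ countable [set: T].
Proof.
move=> /countable_injP[f inj_f].
pose D : T := fun n => exists A : T, f A = n /\ ~ A n.
have nD : ~ D (f D).
  move=> DfD; have [A [fA nA]] := DfD; apply: nA.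
  by rewrite (inj_f A D) ?inE.
by apply: (nD); exists D.
Qed.

Lemma omega1_exists : exists W : orderTopologicalType Order.default_display,
  is_omega1 W.
Proof.
have [R woR] := wochoice.well_ordering_principle T.
have minR (A : set T) : A !=set0 -> exists2 x, A x & forall y, A y -> R x y.
  move=> [a Aa]; have [|x [[xA xm] _]] := woR [in A].
    by exists a; exact: mem_set.
  by exists x => [|y Ay]; [exact/set_mem|apply: xm; exact/mem_set].
have Rxx : reflexive R.
  by move=> x; have [|y -> ->//] := minR [set x]; exists x.
have Rtot x y : R x y \/ R y x.
  have [|_ [->|->] m] := minR [set x; y]; first by exists x; left.
    by left; apply: m; right.
  by right; apply: m; left.
have Ranti x y : R x y -> R y x -> x = y.
  move=> xy yx; have [|z [_ uz]] := woR [in [set x; y]].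
    by exists x; apply: mem_set; left.
  have m w : w = x \/ w = y -> wochoice.minimum_of R [in [set x; y]] w.
    move=> wxy; split; first exact/mem_set.
    by move=> v /set_mem[] ->; case: wxy => ->.
  by rewrite -(uz x) ?(uz y)//; apply: m; [right|left].
have Rtrans x y z : R x y -> R y z -> R x z.
  move=> xy yz; have [|w wxyz m] := minR [set x; y; z].
    by exists x; left; left.
  case: wxyz m => [[]|] -> m; first by apply: m; right.
    by rewrite (Ranti x y)//; apply: m; left; left.
  by rewrite -(Ranti y z)//; apply: m; left; right.
pose U := {x : T | `[< countable [set y | R y x] >]}.
pose le : rel U := fun x y => R (val x) (val y).
have le_refl : reflexive le by move=> x; exact: Rxx.
have le_anti : antisymmetric le.
  by move=> x y /andP[xy yx]; apply: val_inj; exact: Ranti.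
have le_trans : transitive le by move=> y x z; exact: Rtrans.
pose pU := HB.pack_for (porderType Order.default_display) U
  (Order.Le_isPOrder.Build Order.default_display U le_refl le_anti le_trans).
have le_total : total (<=%O : rel pU).
  by move=> x y; apply/orP; exact: Rtot.
pose oU := HB.pack_for (orderType Order.default_display) U pU
  (Order.POrder_isTotal.Build Order.default_display pU le_total).
exists (order_topology oU); split.
- apply: wochoice.antisymmetric_well_order => [|A [a aA]]; first exact: le_anti.
  have [|_ [x xA <-] m] := minR (val @` [set x : U | x \in A]).
    by exists (val a), a.
  by exists x; split=> // y yA; apply: m; exists y.
- move=> a; have /asboolP/countable_injP[f f_inj] := valP (a : U).
  apply/countable_injP; exists (f \o val) => x y /set_mem/ltW xa /set_mem/ltW ya.
  by move=> fxy; apply/val_inj/f_inj => //; exact/mem_set.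
- move=> /countable_injP[g g_inj].
  pose seg x := [set y | R y x].
  pose h (x : T) : nat :=
    if pselect (`[< countable (seg x) >]) is left p then (g (exist _ x p)).+1
    else 0%N.
  have h_inj x y : countable (seg x) \/ countable (seg y) -> h x = h y -> x = y.
    rewrite /h; case: pselect => [p|np]; case: pselect => [q|nq].
    - by move=> _ [] /g_inj; rewrite !inE => /(_ I I) [].
    - by [].
    - by [].
    - by case=> c; [case: np|case: nq]; exact: asboolT.
  have [B0|] := pselect ([set x | ~ countable (seg x)] !=set0).
    have [b nb bm] := minR _ B0; apply: nb.
    apply/countable_injP; exists h => x y /set_mem xb /set_mem yb.
    have cseg z : R z b -> z <> b -> countable (seg z).
      move=> zb nzb; apply: contrapT => nz; apply: nzb.
      by apply: Ranti => //; exact: bm.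
    have [->|nxb] := pselect (x = b).
      have [->//|nyb] := pselect (y = b).
      by apply: h_inj; right; exact: cseg.
    by apply: h_inj; left; exact: cseg.
  move=> B0; apply: T_uncountable; apply/countable_injP; exists h => x y _ _.
  by apply: h_inj; left; apply: contrapT => nx; apply: B0; exists x.
Qed.
End omega1_existence.

(* b = a + 1 *)
Definition is_succ d (W : orderType d) (a b : W) :=
  (a < b)%O /\ forall c, (a < c)%O -> (b <= c)%O.

Definition L0 d (W : orderType d) : set (W * W) :=
  \bigcup_a ([set x | (x <= a)%O] `*` [set b | is_succ a b]).
Arguments L0 {d} W.

(* Main.v *)
Require Import Defs.
From HB Require Import structures.
From mathcomp Require Import all_boot all_order all_algebra.
From mathcomp Require Import all_classical all_reals all_analysis.
From mathcomp Require Import complex.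

Set Implicit Arguments.
Unset Strict Implicit.
Unset Printing Implicit Defensive.

Import Order.TTheory GRing.Theory Num.Theory.
Import numFieldNormedType.Exports.

Local Open Scope classical_set_scope.
Local Open Scope ring_scope.

(* A bounded functional on X = C_0[0,omega_1) is determined by its values on the
   indicator functions chi_g of [0,g], and these values are eventually constant
   in g. Hence there is a club D on which (P f)(x) = l(x) f(x) for all f; as P
   is a projection l(x) is 0 or 1, and since l is continuous, D may be chosen so
   that l is constant. Replacing P by 1 - P, let l = 0. Then the range of P
   consists of functions vanishing on D, and the intervals of [0,omega_1) \ D
   embed in distinct blocks of L_0. Writing q = (1 - P) e, where e is the
   projection of X onto the functions vanishing on D, the kernel of P is
   isomorphic to X + range q. Now omega copies of [0,omega_1) \ D fit into
   [0,omega_1) as the complement of another club, so the c_0-sum of countably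
   many copies of range q is complemented in X, and a swindle absorbs the
   summand range q. *)

(** * Closed unbounded subsets of omega_1 *)

Section omega1.
Context d (W : orderTopologicalType d) (W1 : is_omega1 W).
Implicit Types (x y z a b : W) (A D : set W).
Local Open Scope order_scope.

Lemma omega1_min A : A !=set0 -> exists2 m, A m & forall y, A y -> m <= y.
Proof.
case: W1 => wo _ _ [a Aa]; have [|m [[mA mm] _]] := wo [in A].
  by exists a; exact: mem_set.
by exists m => [|y Ay]; [exact/set_mem|apply: mm; exact/mem_set].
Qed.

Lemma omega1_inhabited : [set: W] !=set0.
Proof.
case: W1 => _ _ unc; apply/set0P/negP => /eqP w0; apply: unc; rewrite w0.
exact: countable0.
Qed.

Lemma omega1_ind (Q : W -> Prop) :
  (forall x, (forall y, y < x -> Q y) -> Q x) -> forall x, Q x.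
Proof.
move=> ih x; apply: contrapT => nQx.
have [|m nQm mm] := @omega1_min [set y | ~ Q y]; first by exists x.
apply: nQm; apply: ih => y ym; apply: contrapT => /mm.
by rewrite leNgt ym.
Qed.

Lemma countable_lt x : countable [set y | y < x].
Proof. by case: W1. Qed.

Lemma countable_le x : countable [set y | y <= x].
Proof.
apply: (@sub_countable _ _ _ ([set y | y < x] `|` [set x])).
  by apply: subset_card_le => y /=; rewrite le_eqVlt => /orP[/eqP|]; [right|left].
rewrite -bigcup2E; apply: bigcup_countable => // -[|[|n]] _ /=.
- exact: countable_lt.
- exact: countable1.
- exact: countable0.
Qed.

Lemma countable_bounded A : countable A -> exists b, forall a, A a -> a < b.
Proof.
move=> cA; apply: contrapT => /forallNP nb; case: W1 => _ _; apply.
apply: (@sub_countable _ _ _ (\bigcup_(a in A) [set y | y <= a])).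
  apply: subset_card_le => y _; have /existsNP[a /not_implyP[Aa]] := nb y.
  by move=> /negP; rewrite -leNgt => ya; exists a.
by apply: bigcup_countable => // a _; exact: countable_le.
Qed.

Lemma seq_bounded (u : nat -> W) : exists b, forall n, u n < b.
Proof.
have [|b bP] := @countable_bounded (range u); first exact: card_image_le.
by exists b => n; apply: bP; exists n.
Qed.

Lemma exists_gt x : exists y, x < y.
Proof. by have [b /(_ 0%N)] := seq_bounded (fun=> x); exists b. Qed.

Lemma exists_succ x : exists y, is_succ x y.
Proof.
have [y xy mn] := @omega1_min [set y | x < y] (exists_gt x).
by exists y; split.
Qed.

(** The successor of [x] makes each [(a, x]] open, so these intervals form a base at [x]. The clause
    over [z < x] is vacuous for the least element, which is isolated. *)
Lemma nbhs_omega1 x A : nbhs x A <->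
  A x /\ forall z, z < x -> exists2 a, a < x & forall y, a < y <= x -> A y.
Proof.
split=> [xA|[Ax xA]].
  split=> [|z zx]; first exact: nbhs_singleton.
  move: xA; rewrite itv_nbhsE => -[[l r] /= [op xi] sub].
  case: l op xi sub => [[] l|[]] op xi sub.
  - by case: r op xi sub => [[] r|[]].
  - exists l => [|y /andP[ly yx]]; first by move: xi => /andP[].
    apply: sub; move: xi; rewrite /= !in_itv/= ly /= => /andP[_].
    case: r op => [[] r|[]] //= _; exact: le_lt_trans.
  - exists z => // y /andP[_ yx].
    apply: sub; move: xi; rewrite /= !in_itv/=.
    case: r op => [[] r|[]] //= _; exact: le_lt_trans.
  - by case: r op xi sub => [[] r|[]].
have [s [xs smin]] := exists_succ x.
rewrite itv_nbhsE.
have [[z zx]|nz] := pselect (exists z, z < x).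
  have [a ax aA] := xA z zx.
  exists `]a, s[; first by rewrite /= in_itv/= ax xs.
  move=> y; rewrite /= in_itv/= => /andP[ay ys]; apply: aA.
  by rewrite ay /= leNgt; apply/negP => /smin; rewrite leNgt ys.
exists `]-oo, s[; first by rewrite /= in_itv/= xs; split => //; left.
move=> y; rewrite /= in_itv/= => ys.
have yx : y <= x by rewrite leNgt; apply/negP => /smin; rewrite leNgt ys.
have [->//|ne] := eqVneq y x.
by exfalso; apply: nz; exists y; rewrite lt_neqAle ne.
Qed.

(** Only limits from the left matter. The premise [z < x] spares the least element, at which the
    approximation condition is vacuous. *)
Lemma closed_omega1 A :
  (forall x z, z < x -> (forall a, a < x -> exists2 y, a < y <= x & A y) -> A x) ->
  closed A.
Proof.
move=> cA; rewrite -[A]setCK; apply: open_closedC; rewrite openE => x nAx.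
apply/nbhs_omega1; split=> // z zx; apply: contrapT => h.
apply: nAx; apply: (cA x z zx) => a ax; apply: contrapT => ha.
by apply: h; exists a => // y yx Ay; apply: ha; exists y.
Qed.

Lemma closed_limit A x z : closed A -> z < x ->
  (forall a, a < x -> exists2 y, a < y <= x & A y) -> A x.
Proof.
move=> cA zx h; apply: contrapT => nAx.
have /nbhs_omega1[_ /(_ z zx)[a /h[y yx Ay] /(_ y yx)]] : nbhs x (~` A) => //.
by apply: open_nbhs_nbhs; split=> //; exact: closed_openC.
Qed.

Lemma closed_gt a : closed [set x | a < x].
Proof.
apply: closed_omega1 => x z zx h.
rewrite /= ltNge; apply/negP => xa.
have [y /andP[zy yx] ay] := h z zx.
by have := lt_le_trans ay (le_trans yx xa); rewrite ltxx.
Qed.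

Lemma open_le a : open [set x | x <= a].
Proof.
have -> : [set x | x <= a] = ~` [set x | a < x].
  by apply/seteqP; split=> x /=; rewrite leNgt => /negP.
exact/closed_openC/closed_gt.
Qed.

Lemma open_gt a : open [set x | a < x].
Proof. by have := rray_open a; rewrite set_itvE. Qed.

(** By induction on [a]: one neighbourhood of [a] covers some [(b, a]], and the induction hypothesis
    handles [[0, b]]. *)
Lemma compact_le a : compact [set x | x <= a].
Proof.
apply/compact_near_coveringP => I F Q FF.
elim/omega1_ind: a => a ih QP.
have [[/= U V] [Ua FV] UV] := QP a (lexx a).
have [Qa aU] := (nbhs_omega1 a U).1 Ua.
have [[z za]|nz] := pselect (exists z, z < a); last first.
  apply: filterS FV => i Vi y /= ya; apply: (UV (y, i)); split=> //=.
  have [->//|ne] := eqVneq y a.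
  by exfalso; apply: nz; exists y; rewrite lt_neqAle ne.
have [b ba bU] := aU z za.
have Fb : \forall i \near F, forall y, y <= b -> Q i y.
  by apply: ih => // y yb; apply: QP; exact: le_trans yb (ltW ba).
apply: filterS2 FV Fb => i Vi Qi y /= ya.
have [yb|by_] := leP y b; first exact: Qi.
by apply: (UV (y, i)); split=> //=; apply: bU; rewrite by_ ya.
Qed.

(** The initial segments are open and exhaust [W]; the near-covering form of compactness, applied to
    the filter of tails, yields one that contains [A]. *)
Lemma compact_bounded_above A : compact A -> exists b, forall x, A x -> x <= b.
Proof.
move=> /compact_near_coveringP cA; have [A0|nA] := pselect (A !=set0); last first.
  have [w _] := omega1_inhabited.
  by exists w => x Ax; exfalso; apply: nA; exists x.
pose F : set_system W := [set B | exists b, forall y, b <= y -> B y].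
have FF : Filter F.
  split; first by case: A0 => a _; exists a.
    move=> B C [b bB] [c cC]; exists (Order.max b c) => y.
    by rewrite ge_max => /andP[by_ cy]; split; [exact: bB|exact: cC].
  by move=> B C BC [b bB]; exists b => y /bB /BC.
have [|b bP] := cA W F (fun b x => x <= b) FF.
  move=> x _; exists ([set y | y <= x], [set b | x <= b]) => /=.
    by split; [apply: open_nbhs_nbhs; split=> //=; exact: open_le|exists x].
  by move=> [y b] /= [yx xb]; exact: le_trans xb.
by exists b => x Ax; exact: bP (lexx b) x Ax.
Qed.

(** Initial segments are countable, so some [G] has [G x] above [x] and above all values of [H] on
    [[0, x]]. The supremum of the orbit of [b] under [G] is as required. *)
Lemma closed_under_unbounded (H : W -> W) b :
  exists2 c, b < c & forall x, x < c -> H x < c.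
Proof.
have Hb x : exists y, x < y /\ forall z, z <= x -> H z < y.
  have [y yP] : exists y, forall z, z <= x -> H z < y.
    have [|y yP] := @countable_bounded (H @` [set z | z <= x]).
      by apply: sub_countable (countable_le x); exact: card_image_le.
    by exists y => z zx; apply: yP; exists z.
  have [s xs] := exists_gt x; exists (Order.max y s); split.
    by rewrite lt_max xs orbT.
  by move=> z /yP zy; rewrite lt_max zy.
have [G GP] := choice Hb.
have [c0 c0P] := seq_bounded (fun n => iter n G b).
have [c cP cm] := @omega1_min [set c | forall n, iter n G b < c] (ex_intro _ c0 c0P).
exists c; first exact: (cP 0%N).
move=> x xc.
have [n xn] : exists n, x < iter n G b.
  apply: contrapT => /forallNP nx.
  have /cm : [set c | forall n, iter n G b < c] x.
    move=> n; apply: lt_le_trans (proj1 (GP _)) _.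
    by have /negP := nx n.+1; rewrite -leNgt.
  by rewrite leNgt xc.
apply: lt_trans (cP n.+1); rewrite iterS; apply: (proj2 (GP _)); exact: ltW.
Qed.

Lemma closed_under_closed (H : W -> W) : closed [set c | forall x, x < c -> H x < c].
Proof.
apply: closed_omega1 => c z zc h x xc.
have [y /andP[xy yc] yH] := h x xc.
exact: lt_le_trans (yH x xy) yc.
Qed.


(* By the Galois connection, [th (sg x)] is the least element of [D] above [x]. *)
Definition enumerates D (th sg : W -> W) :=
  [/\ forall w, D (th w), forall x, D x -> th (sg x) = x, cancel th sg,
     forall x w, (sg x <= w) = (x <= th w) & continuous th /\ continuous sg].

(** [th] lists [D] increasingly by well-founded recursion. Unboundedness keeps the recursion going,
    and closedness makes [th] continuous at limits. *)
Lemma enumeration D : closed D -> (forall x, exists2 y, D y & x < y) ->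
  exists th sg, enumerates D th sg.
Proof.
move=> cD uD.
have wf : well_founded (fun x y : W => x < y).
  by elim/omega1_ind => x ih; constructor => y /ih.
(* [mn] picks least elements, with an arbitrary value on the empty set, so that the recursion is
   total. *)
have /choice[mn mnP] (A : set W) :
    exists m, A !=set0 -> A m /\ forall y, A y -> m <= y.
  have [/omega1_min[m Am mm]|nA] := pselect (A !=set0); first by exists m.
  by have [w _] := omega1_inhabited; exists w => /nA.
pose th := Fix wf (fun=> W) (fun w f =>
  mn [set x | D x /\ forall v (vw : v < w), f v vw < x]).
have thE w : th w = mn [set x | D x /\ forall v, v < w -> th v < x].
  rewrite /th Fix_eq // => x f g fg; congr mn.
  apply/seteqP; split => y [Dy h]; split => // v vw.
    by rewrite -fg.
  by rewrite fg.
have thP w : (D (th w) /\ forall v, v < w -> th v < th w) /\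
    forall x, D x -> (forall v, v < w -> th v < x) -> th w <= x.
  rewrite thE; set A := [set x | _]; have /mnP[mA mm] : A !=set0.
    have [|b bP] := @countable_bounded (th @` [set v | v < w]).
      by apply: sub_countable (countable_lt w); exact: card_image_le.
    have [y Dy by_] := uD b; exists y; split=> // v vw.
    by apply: lt_trans by_; apply: bP; exists v.
  by split=> // x Dx xP; apply: mm.
have thD w : D (th w) by case: (thP w) => [[]].
have th_lt v w : v < w -> th v < th w by case: (thP w) => [[]] _ + _; exact.
have th_min w x : D x -> (forall v, v < w -> th v < x) -> th w <= x.
  by case: (thP w) => _; exact.
have th_le v w : (th v <= th w) = (v <= w).
  case: (ltgtP v w) => [/th_lt/ltW//|/th_lt|->]; last exact: lexx.
  by rewrite ltNge => /negbTE.
have le_th w : w <= th w.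
  elim/omega1_ind: w => w ih; rewrite leNgt; apply/negP => h.
  by have := ih _ h; rewrite leNgt th_lt.
pose sg x := mn [set w | x <= th w].
have sgP x : x <= th (sg x) /\ forall w, x <= th w -> sg x <= w.
  by apply: (mnP [set w | x <= th w]); exists x; exact: le_th.
have galois x w : (sg x <= w) = (x <= th w).
  apply/idP/idP => [h|]; last by case: (sgP x) => _; exact.
  by apply: le_trans (proj1 (sgP x)) _; rewrite th_le.
have thsg x : D x -> th (sg x) = x.
  move=> Dx; apply/le_anti; rewrite (proj1 (sgP x)) andbT.
  apply: th_min => // v vx; rewrite ltNge; apply/negP => /(proj2 (sgP x)).
  by rewrite leNgt vx.
have sgth : cancel th sg.
  by move=> w; apply/le_anti; rewrite galois lexx/= -th_le -galois.
exists th, sg; split=> //; split.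
- move=> w A /nbhs_omega1[Aw wA]; apply/nbhs_omega1; split=> // z zw.
  have [b bw bA] := wA _ (th_lt _ _ zw).
  have [[v vw bv]|nv] := pselect (exists2 v, v < w & b < th v).
    exists v => // y /andP[vy yw]; apply: bA.
    by rewrite th_le yw andbT (lt_trans bv)// th_lt.
  have [[v vw vP]|lim] := pselect (exists2 v, v < w & forall u, v < u -> w <= u).
    exists v => // y /andP[/vP wy yw]; suff -> : y = w by [].
    by apply/le_anti; rewrite yw wy.
  have vb v : v < w -> th v <= b.
    by move=> vw; rewrite leNgt; apply/negP => h; apply: nv; exists v.
  (* Now [w] is a limit and all earlier [th v] are at most [b]. Their supremum [m] lies in [D] by
     closedness, so [th w <= m <= b], against [b < th w]. *)
  pose m := mn [set x | forall v, v < w -> th v <= x].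
  have [mP mm] := mnP [set x | forall v, v < w -> th v <= x] (ex_intro _ b vb).
  have gtv v : v < w -> exists2 v', v < v' & v' < w.
    move=> vw; apply: contrapT => h; apply: lim; exists v => // u vu.
    by rewrite leNgt; apply/negP => uw; apply: h; exists u.
  have mlt v : v < w -> th v < m.
    by move=> /gtv[v' vv' /mP]; apply: lt_le_trans; exact: th_lt.
  suff Dm : D m.
    have : th w <= b by apply: le_trans (th_min _ _ Dm mlt) (mm b vb).
    by rewrite leNgt bw.
  apply: (closed_limit cD (mlt z zw)) => a am.
  apply: contrapT => na; have : m <= a; last by rewrite leNgt am.
  apply: mm => v vw; rewrite leNgt; apply/negP => av; apply: na.
  by exists (th v) => //; rewrite av mP.
- move=> x A /nbhs_omega1[Ax xA]; apply/nbhs_omega1; split=> // z zx.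
  have [[u ux]|nu] := pselect (exists u, u < sg x); last first.
    exists z => // y /andP[_ yx].
    have : sg y <= sg x by rewrite galois (le_trans yx)// -galois.
    rewrite le_eqVlt => /orP[/eqP syx|yx']; first by rewrite /preimage/= syx.
    by exfalso; apply: nu; exists (sg y).
  have [b bx bA] := xA u ux.
  (* By the Galois connection [th b < y] is equivalent to [b < sg y], which dictates this
     endpoint. *)
  exists (th b) => [|y /andP[by_ yx]]; first by rewrite ltNge -galois -ltNge.
  apply: bA; rewrite galois (le_trans yx) -?galois// andbT.
  by rewrite ltNge galois -ltNge.
Qed.

Section enumerates.
Context D (th sg : W -> W) (ths : enumerates D th sg).

Lemma enum_le v w : (th v <= th w) = (v <= w).
Proof. by case: ths => _ _ sgth g _; rewrite -g sgth. Qed.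

Lemma enum_lt v w : (th v < th w) = (v < w).
Proof. by rewrite !ltNge enum_le. Qed.

Lemma le_enum w : w <= th w.
Proof.
elim/omega1_ind: w => w ih; rewrite leNgt; apply/negP => h.
by have := ih _ h; rewrite leNgt enum_lt h.
Qed.

Lemma le_next x : x <= th (sg x).
Proof. by case: ths => _ _ _ g _; rewrite -g. Qed.

Lemma next_min x y : D y -> x <= y -> th (sg x) <= y.
Proof.
by case: ths => _ thsg _ g _ Dy xy; rewrite -(thsg y Dy) enum_le g thsg.
Qed.

Lemma next_D x : D (th (sg x)).
Proof. by case: ths. Qed.

(** Some interval [(a, x]] misses [D], and all its points have the same next element of [D]. *)
Lemma next_locally_constant x : closed D -> ~ D x ->
  nbhs x [set y | ~ D y /\ th (sg y) = th (sg x)].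
Proof.
move=> cD nDx; have := closed_openC cD; rewrite openE => /(_ x nDx).
move=> /nbhs_omega1[_ h]; apply/nbhs_omega1; split=> // z zx.
have [a ax aD] := h z zx; exists a => // y yax; split; first exact: aD.
move/andP: (yax) => [ay yx]; apply/le_anti/andP; split.
  by apply: next_min; [exact: next_D|exact: le_trans (le_next x)].
apply: next_min; first exact: next_D.
rewrite leNgt; apply/negP => yx'.
have /aD : a < th (sg y) <= x by rewrite (lt_le_trans ay (le_next y)) ltW.
by apply; exact: next_D.
Qed.

End enumerates.

End omega1.

(** * Bounded linear maps and the swindle *)

Section bounded_linear.
Context (K : numFieldType).

Definition bounded_linear (U V : normedModType K) (f : U -> V) :=
  linear f /\ exists M : K, forall x, `|f x| <= M * `|x|.

(** The given [M] need not be nonnegative if [U] is trivial. But [M * |x|] bounds a norm, so it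
    equals [|M| * |x|]. *)
Lemma bounded_linear_bound (U V : normedModType K) (f : U -> V) :
  bounded_linear f -> exists2 M : K, 0 <= M & forall x, `|f x| <= M * `|x|.
Proof.
move=> [_ [M fM]]; exists `|M| => // x.
have M0 : 0 <= M * `|x| := le_trans (normr_ge0 _) (fM x).
by rewrite -[X in _ * X]normr_id -normrM (ger0_norm M0).
Qed.

Lemma bounded_linearD (U V : normedModType K) (f : U -> V) :
  bounded_linear f -> {morph f : x y / x + y}.
Proof. by move=> [lf _] x y; have := lf 1 x y; rewrite !scale1r. Qed.

Lemma bounded_linearB (U V : normedModType K) (f : U -> V) :
  bounded_linear f -> {morph f : x y / x - y}.
Proof.
by move=> [lf _] x y; rewrite addrC -scaleN1r lf scaleN1r addrC.
Qed.

Lemma bounded_linear0 (U V : normedModType K) (f : U -> V) :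
  bounded_linear f -> f 0 = 0.
Proof. by move=> bf; rewrite -(subrr 0) (bounded_linearB bf) subrr. Qed.

Lemma bounded_linear_comp (U V V' : normedModType K) (f : U -> V) (g : V -> V') :
  bounded_linear f -> bounded_linear g -> bounded_linear (fun x => g (f x)).
Proof.
move=> [lf [M fM]] bg; have [N N0 gN] := bounded_linear_bound bg.
case: bg => lg _; split=> [a x y|]; first by rewrite lf lg.
exists (N * M) => x; apply: le_trans (gN _) _.
by rewrite -mulrA ler_wpM2l.
Qed.

Lemma bounded_linear_add (U V : normedModType K) (f g : U -> V) :
  bounded_linear f -> bounded_linear g -> bounded_linear (fun x => f x + g x).
Proof.
move=> [lf [M fM]] [lg [N gN]]; split=> [a x y|].
  by rewrite lf lg scalerDr addrACA.
exists (M + N) => x; apply: le_trans (ler_normD _ _) _.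
by rewrite mulrDl lerD.
Qed.

Lemma bounded_linear_sub (U V : normedModType K) (f g : U -> V) :
  bounded_linear f -> bounded_linear g -> bounded_linear (fun x => f x - g x).
Proof.
move=> [lf [M fM]] [lg [N gN]]; split=> [a x y|].
  by rewrite lf lg scalerBr opprD addrACA.
exists (M + N) => x; apply: le_trans (ler_normB _ _) _.
by rewrite mulrDl lerD.
Qed.

Lemma bounded_linear_id (U : normedModType K) : bounded_linear (@id U).
Proof. by split=> //; exists 1 => x; rewrite mul1r. Qed.

Lemma lipschitz_continuous_within (U V : normedModType K) (A : set U)
    (f : U -> V) (M : K) :
  (forall x y, A x -> A y -> `|f x - f y| <= M * `|x - y|) ->
  {within A, continuous f}.
Proof.
move=> fM; have fM' x y : A x -> A y -> `|f x - f y| <= (1 + `|M|) * `|x - y|.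
  move=> Ax Ay; have M0 : 0 <= M * `|x - y|.
    exact: le_trans (normr_ge0 _) (fM x y Ax Ay).
  rewrite mulrDl mul1r -[X in _ + _ * X]normr_id -normrM (ger0_norm M0).
  by apply: le_trans (fM x y Ax Ay) _; rewrite lerDr.
have N0 : 0 < 1 + `|M| by rewrite ltr_pwDl.
apply/subspace_continuousP => x Ax; apply/cvgrPdist_lt => e e0.
have d0 : 0 < e / (1 + `|M|) by rewrite divr_gt0.
rewrite near_withinE; near=> y => Ay.
apply: le_lt_trans (fM' _ _ Ax Ay) _.
rewrite -ltr_pdivlMl// mulrC; near: y.
by apply: cvgr_dist_lt d0; exact: cvg_id.
Unshelve. all: by end_near. Qed.

Lemma bounded_linear_continuous_within (U V : normedModType K) (A : set U)
    (f : U -> V) :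
  bounded_linear f -> {within A, continuous f}.
Proof.
move=> bf; have [M M0 fM] := bounded_linear_bound bf.
apply: (@lipschitz_continuous_within _ _ _ _ M) => x y _ _.
by rewrite -(bounded_linearB bf).
Qed.

(** As [t r = 1], the map [1 - r t] projects onto [ker t], which contains the range of [P] by
    [t P = 0]. Hence [q = (1 - P)(1 - r t)] projects onto the intersection of [ker t] and
    [ker P]. *)
Lemma projection_facts (X : normedModType K) (P t r q : X -> X) :
  bounded_linear P -> bounded_linear t -> bounded_linear r ->
  (forall f, q f = f - r (t f) - P (f - r (t f))) ->
  (forall f, P (P f) = P f) -> (forall f, t (r f) = f) ->
  (forall f, t (P f) = 0) ->
  [/\ bounded_linear q, forall f, t (q f) = 0, forall f, P (q f) = 0 &
    [/\ forall f, q (q f) = q f, forall f, q (r f) = 0 &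
        forall f, q (P f) = 0]].
Proof.
move=> bP bt br qE PP tr tP.
have q_bl : bounded_linear q.
  rewrite (_ : q = fun f => f - r (t f) - P (f - r (t f))); last exact/funext.
  have be : bounded_linear (fun f => f - r (t f)).
    apply: bounded_linear_sub; first exact: bounded_linear_id.
    exact: bounded_linear_comp.
  by apply: bounded_linear_sub => //; exact: (bounded_linear_comp be bP).
have tq f : t (q f) = 0.
  by rewrite qE !(bounded_linearB bt) tr tP subrr subr0.
have Pq f : P (q f) = 0 by rewrite qE (bounded_linearB bP) PP subrr.
split=> //; split=> f.
- by rewrite [LHS]qE tq (bounded_linear0 br) subr0 Pq subr0.
- by rewrite qE tr subrr (bounded_linear0 bP) subr0.
- by rewrite qE tP (bounded_linear0 br) !subr0 PP subrr.
Qed.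

(* Linear algebra behind [ker P ~ X].  With [e = 1 - r t] and [q = (1 - P) e],
   [ker P] is the sum of the range of [q] and a copy of [X] along [t]. The
   range of [A], a complemented subspace of [X], consists of sequences in the
   range of [q]; shifting them makes room for the first summand. *)
Lemma eilenberg_swindle (X Z : normedModType K) (P t r q : X -> X) (A : X -> Z)
    (B : Z -> X) (qZ s s' : Z -> Z) (i0 : X -> Z) (p0 : Z -> X) :
  bounded_linear P -> bounded_linear t -> bounded_linear r ->
  (forall f, q f = f - r (t f) - P (f - r (t f))) ->
  bounded_linear A -> bounded_linear B -> bounded_linear qZ ->
  bounded_linear s -> bounded_linear s' ->
  bounded_linear i0 -> bounded_linear p0 ->
  (forall f, P (P f) = P f) -> (forall f, t (r f) = f) ->
  (forall f, t (P f) = 0) ->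
  (forall f, qZ (A f) = A f) -> (forall z, qZ z = z -> A (B z) = z) ->
  (forall z, qZ (s z) = s (qZ z)) -> (forall z, qZ (s' z) = s' (qZ z)) ->
  (forall f, qZ (i0 f) = i0 (q f)) -> (forall z, p0 (qZ z) = q (p0 z)) ->
  (forall z, s' (s z) = z) -> (forall z, p0 (s z) = 0) ->
  (forall f, s' (i0 f) = 0) -> (forall f, p0 (i0 f) = f) ->
  (forall z, i0 (p0 z) + s (s' z) = z) ->
  isomorphic [set f | P f = 0] [set: X].
Proof.
move=> bP bt br qE bA bB bq bs bs' bi bp PP tr tP qA AB qs qs' qi pq s's ps s'i
  pi ips.
have [q_bl tq Pq [qq qr qP]] := projection_facts bP bt br qE PP tr tP.
(* Since [A B = 1] on the range of [qZ], the vector [x + B (z - A x)] is [x] with its sequence [A x]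
   replaced by [z]. Thus [T] prepends [q f] to the sequence of [t f], and [v] drops the first term
   again. *)
pose T f := t f + B (i0 (q f) + s (A (t f)) - A (t f)).
pose v y := y + B (s' (A y) - A y).
(* On [ker P] one has [f = q f + (1 - P) (r (t f))]; [S] uses this formula, with [q f] and [t f]
   recovered from [y]. *)
pose S y := p0 (A y) + (r (v y) - P (r (v y))).
have AT f : A (T f) = i0 (q f) + s (A (t f)).
  rewrite /T (bounded_linearD bA) AB; first by rewrite addrC subrK.
  by rewrite (bounded_linearB bq) (bounded_linearD bq) qi qs qq !qA.
have pA y : q (p0 (A y)) = p0 (A y) by rewrite -pq qA.
have tS y : t (S y) = v y.
  rewrite /S (bounded_linearD bt) (bounded_linearB bt) tP subr0 tr -pA tq.
  by rewrite add0r.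
have qS y : q (S y) = p0 (A y).
  by rewrite /S (bounded_linearD q_bl) (bounded_linearB q_bl) qP qr subr0 addr0 pA.
have Av y : A (v y) = s' (A y).
  rewrite /v (bounded_linearD bA) AB; first by rewrite addrC subrK.
  by rewrite (bounded_linearB bq) qs' !qA.
have T_bl : bounded_linear T.
  apply: (bounded_linear_add bt); apply: (bounded_linear_comp _ bB).
  have bAt := bounded_linear_comp bt bA.
  apply: (bounded_linear_sub _ bAt).
  apply: (bounded_linear_add (bounded_linear_comp q_bl bi)).
  exact: (bounded_linear_comp bAt bs).
have v_bl : bounded_linear v.
  apply: (bounded_linear_add (@bounded_linear_id _)).
  apply: (bounded_linear_comp _ bB).
  by apply: bounded_linear_sub => //; exact: (bounded_linear_comp bA bs').
have S_bl : bounded_linear S.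
  apply: (bounded_linear_add (bounded_linear_comp bA bp)).
  have brv := bounded_linear_comp v_bl br.
  exact: (bounded_linear_sub brv (bounded_linear_comp brv bP)).
exists T, S; split=> //.
- move=> y _ /=; rewrite /S (bounded_linearD bP) (bounded_linearB bP) PP subrr.
  by rewrite addr0 -pA Pq.
- move=> f /set_mem /= Pf; rewrite /S /v AT.
  rewrite (bounded_linearD bp) pi ps addr0 (bounded_linearD bs') s'i add0r s's.
  rewrite /T -addrA -(bounded_linearD bB).
  rewrite [X in B X](_ : _ = 0).
    rewrite (bounded_linear0 bB) addr0 qE (bounded_linearB bP) Pf sub0r opprK.
    by rewrite addrACA subrK subrr addr0.
  by rewrite addrA subrK subrr.
- move=> y _; rewrite /T tS qS Av /v -addrA -(bounded_linearD bB).
  rewrite [X in B X](_ : _ = 0) ?(bounded_linear0 bB) ?addr0//.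
  by rewrite ips addrA subrK subrr.
- split; first by move=> a x y _ _; rewrite (proj1 T_bl).
    exact: bounded_linear_continuous_within.
  exact: bounded_linear_continuous_within.
Qed.

End bounded_linear.

(** * Operators between spaces C_0(L) *)

Section C0_operators.
Context (K : numFieldType).

Lemma norm_leNgt (a e : K) : 0 < e -> (e <= `|a|) = ~~ (`|a| < e).
Proof. by move=> e0; rewrite real_ltNge ?negbK ?normr_real ?gtr0_real. Qed.

Lemma closed_norm_ge (L : topologicalType) (f : L -> K^o) (e : K) :
  0 < e -> continuous f -> closed [set x | e <= `|f x|].
Proof.
move=> e0 cf; have -> : [set x | e <= `|f x|] = ~` [set x | `|f x| < e].
  by apply/seteqP; split => x /=; rewrite norm_leNgt// => /negP.
apply: open_closedC; rewrite openE => x /= fx.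
exact: (cvgr_norm_lt (f x) (cf x)).
Qed.

Lemma compact_norm_ge (L : topologicalType) (f : C0 K L) (e : K) :
  0 < e -> compact [set x | e <= `|f x|].
Proof. by have [_] := elimT (isC0P _) (C0P f); exact. Qed.

Lemma C0_ext (L : topologicalType) (f g : C0 K L) : f =1 g -> f = g.
Proof. by move=> fg; apply/val_inj/funext. Qed.

Lemma C0_addE (L : topologicalType) (f g : C0 K L) x : (f + g) x = f x + g x.
Proof. by []. Qed.

Lemma C0_subE (L : topologicalType) (f g : C0 K L) x : (f - g) x = f x - g x.
Proof. by []. Qed.

Lemma C0_scaleE (L : topologicalType) a (f : C0 K L) x : (a *: f) x = a * f x.
Proof. by []. Qed.

Lemma C0_norm_le (L : topologicalType) (f : C0 K L) (M : K) :
  0 <= M -> (forall x, `|f x| <= M) -> `|f| <= M.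
Proof. exact: sup_norm_le. Qed.

Lemma C0_le_norm (L : topologicalType) (f : C0 K L) x : `|f x| <= `|f|.
Proof. exact: sup_norm_ub. Qed.

Section composition.
Context (L L' : topologicalType) (phi : L -> L').
Context (phiC0 : forall f : C0 K L', (fun x => f (phi x)) \in @isC0 K L).

Definition comp_op (f : C0 K L') : C0 K L := MkC0 (phiC0 f).

Lemma comp_op_bounded_linear : bounded_linear comp_op.
Proof.
split=> [a f g|]; first exact: C0_ext.
exists 1 => f; rewrite mul1r; apply: C0_norm_le => // x.
exact: (C0_le_norm f (phi x)).
Qed.

End composition.

(** A closed embedding is proper: the set where [|f (phi x)| >= e] is the image under [psi] of a
    compact set intersected with the closed set [range phi]. *)
Lemma isC0_closed_embedding (L L' : topologicalType) (phi : L -> L')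
    (psi : L' -> L) :
  continuous phi -> continuous psi -> cancel phi psi -> closed (range phi) ->
  forall f : C0 K L', (fun x => f (phi x)) \in @isC0 K L.
Proof.
move=> cphi cpsi phiK crange f; apply/isC0P; split.
  by move=> x; apply: continuous_comp; [exact: cphi|exact: C0_continuous].
move=> e e0.
have -> : [set x | e <= `|f (phi x)|] =
    psi @` ([set y | e <= `|f y|] `&` range phi).
  apply/seteqP; split=> [x /= ex|x [y [/= ey [x' _ ph]] <-]]; last first.
    by rewrite -ph phiK ph.
  by exists (phi x); rewrite ?phiK//; split=> //; exists x.
apply: continuous_compact; first exact: continuous_subspaceT.
apply: compact_closedI => //; exact: compact_norm_ge.
Qed.

(* [F] maps the open set [U] homeomorphically onto the open set [U'], with
   inverse [G]; the values of [F] and [G] elsewhere are irrelevant. *)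
Definition partial_homeo (L L' : topologicalType) (U : set L) (U' : set L')
    (F : L -> L') (G : L' -> L) :=
  [/\ open U', forall x, U x -> U' (F x) /\ G (F x) = x,
      forall y, U' y -> U (G y) /\ F (G y) = y,
      forall x, U x -> {for x, continuous F} &
      forall y, U' y -> {for y, continuous G}].

(** * Extension by zero along a homeomorphism of open sets *)

Section transfer.
Context (L L' : topologicalType) (U : set L) (U' : set L').
Context (F : L -> L') (G : L' -> L) (FG : partial_homeo U U' F G).
Context (hL' : hausdorff_space L').

(** The superlevel sets of the extension by zero are images under [F] of those of [f], hence
    compact. As [L'] is Hausdorff they are closed, which gives continuity off [U'], in particular on
    its boundary. *)
Lemma isC0_transfer (f : C0 K L) : (forall x, ~ U x -> f x = 0) ->
  (fun y => if `[< U' y >] then f (G y) else 0 : K^o) \in @isC0 K L'.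
Proof.
move=> f0; case: FG => oU' FP GP cF cG.
set g := (fun y => _).
have gC e : 0 < e -> compact [set y | e <= `|g y|].
  move=> e0; have -> : [set y | e <= `|g y|] = F @` [set x | e <= `|f x|].
    apply/seteqP; split=> [y|_ [x /= ex <-]] /=; rewrite /g.
      case: asboolP => [U'y ey|_]; last by rewrite normr0 lt_geF.
      by exists (G y); rewrite ?(proj2 (GP _ U'y)).
    have Ux : U x.
      by apply: contrapT => /f0 fx; move: ex; rewrite fx normr0 lt_geF.
    have [U'F GF] := FP x Ux.
    by case: asboolP => // _; rewrite GF.
  apply: continuous_compact; last exact: compact_norm_ge.
  apply/subspace_continuousP => x /= ex; apply: cvg_within_filter; apply: cF.
  by apply: contrapT => /f0 fx; move: ex; rewrite fx normr0 lt_geF.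
apply/isC0P; split=> // y.
have [U'y|nU'y] := pselect (U' y).
  have gE : \forall z \near y, f (G z) = g z.
    have := oU'; rewrite openE => /(_ y U'y); apply: filterS => z U'z.
    by rewrite /g; case: asboolP.
  rewrite /continuous_at -(nbhs_singleton gE).
  apply: cvg_trans (near_eq_cvg gE) _.
  apply: (@continuous_comp _ _ _ G f); [exact: cG|exact: C0_continuous].
have gy : g y = 0 by rewrite /g; case: asboolP.
rewrite /continuous_at gy; apply/cvgr0Pnorm_lt => e e0.
have : closed [set z | e <= `|g z|] by apply: compact_closed => //; exact: gC.
move=> /closed_openC; rewrite openE => /(_ y) h.
apply: filterS (h _) => [z /=|]; last by rewrite /= gy normr0 lt_geF.
by move=> /negP; rewrite norm_leNgt// negbK.
Qed.

(** The default 0 makes the map total, while [transfer_off] and [transfer_norm] still hold for every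
    [f]. *)
Definition transfer (f : C0 K L) : C0 K L' :=
  if pselect (forall x, ~ U x -> f x = 0) is left f0 then MkC0 (isC0_transfer f0)
  else 0.

Lemma transferE (f : C0 K L) y : (forall x, ~ U x -> f x = 0) ->
  transfer f y = if `[< U' y >] then f (G y) else 0.
Proof. by rewrite /transfer; case: pselect. Qed.

Lemma transfer_off f y : ~ U' y -> transfer f y = 0.
Proof. by rewrite /transfer; case: pselect => //= _; case: asboolP. Qed.

Lemma transfer_norm f : `|transfer f| <= `|f|.
Proof.
apply: C0_norm_le => // y; rewrite /transfer; case: pselect => [f0|_] /=.
  by case: asboolP => _; [exact: C0_le_norm|rewrite normr0].
by rewrite normr0.
Qed.

Lemma transfer_linear_on :
  linear_on [set f : C0 K L | forall x, ~ U x -> f x = 0] transfer.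
Proof.
move=> a f g f0 g0; apply: C0_ext => y.
rewrite C0_addE C0_scaleE !transferE//; last first.
  by move=> x nUx; rewrite C0_addE C0_scaleE f0// g0// mulr0 addr0.
by case: asboolP => _; rewrite ?mulr0 ?addr0.
Qed.

Lemma transfer_comp_bounded_linear (V : normedModType K) (T : V -> C0 K L) :
  bounded_linear T -> (forall v x, ~ U x -> T v x = 0) ->
  bounded_linear (fun v => transfer (T v)).
Proof.
move=> [lT [M TM]] T0; split=> [a f g|].
  by rewrite lT transfer_linear_on => //=; exact: T0.
by exists M => v; exact: le_trans (transfer_norm _) (TM v).
Qed.

End transfer.

Lemma partial_homeo_sym (L L' : topologicalType) (U : set L) (U' : set L') F G :
  open U -> partial_homeo U U' F G -> partial_homeo U' U G F.
Proof. by move=> oU [_ *]; split. Qed.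

Lemma transferK (L L' : topologicalType) (U : set L) (U' : set L') F G
    (FG : partial_homeo U U' F G) (GF : partial_homeo U' U G F)
    (hL : hausdorff_space L) (hL' : hausdorff_space L') (f : C0 K L) :
  (forall x, ~ U x -> f x = 0) -> transfer GF hL (transfer FG hL' f) = f.
Proof.
move=> f0; apply: C0_ext => x; rewrite transferE; last exact: transfer_off.
case: asboolP => [Ux|/f0//]; have [_ /(_ x Ux)[U'F GFx] _ _ _] := FG.
by rewrite transferE//; case: asboolP => // _; rewrite GFx.
Qed.

(** * The c_0-sum of countably many copies of C_0(L) *)

Section coordinatewise.
Context (L : topologicalType).
Local Notation Z := (C0 K (nat * L)%type).

Lemma nbhs_nat_prod n (x : L) (A : set (nat * L)) :
  nbhs (n, x) A <-> nbhs x [set y | A (n, y)].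
Proof.
split=> [[[B C] /= [nB xC] BC]|xA].
  by apply: filterS xC => y Cy; apply: BC; split=> //=; exact: nbhs_singleton.
exists ([set n], [set y | A (n, y)]) => /=; last by move=> [m y] /= [->].
by split=> //; rewrite nbhs_principalE; exact/principal_filterP.
Qed.

Lemma slice_continuous n : continuous ((fun x => (n, x)) : L -> (nat * L)%type).
Proof. by move=> x A /= /nbhs_nat_prod. Qed.

Lemma nat_prod_continuous (T : topologicalType) (f : nat * L -> T) :
  (forall n, continuous (fun x => f (n, x))) -> continuous f.
Proof. by move=> cf [n x] A /= fA; apply/nbhs_nat_prod; exact: (cf n x A fA). Qed.

Lemma slice_isC0 n (f : Z) : (fun x => f (n, x)) \in @isC0 K L.
Proof.
apply: (@isC0_closed_embedding _ _ (fun x => (n, x)) snd) => //.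
- exact: slice_continuous.
- by move=> x; exact: cvg_snd.
rewrite -[range _]setCK; apply: open_closedC; rewrite openE => -[m x] /= nmx.
apply/nbhs_nat_prod; apply: filterS filterT => y _ /= [_ _ [nm _]].
by apply: nmx; exists x => //; rewrite nm.
Qed.

Definition slice n : Z -> C0 K L := comp_op (slice_isC0 n).

Lemma slice_bounded_linear n : bounded_linear (slice n).
Proof. exact: comp_op_bounded_linear. Qed.

(** A compact superlevel set of [z] meets only finitely many of the open slices. This is what makes
    [C0 K (nat * L)] a c_0-sum. *)
Lemma slice_small (z : Z) (e : K) : 0 < e ->
  exists N, forall n, (N <= n)%N -> `|slice n z| <= e.
Proof.
move=> e0; have /compact_near_coveringP cov := @compact_norm_ge _ z e e0.
have [[n x] _|N _ NP] := cov nat \oo (fun N nx => (nx.1 < N)%N).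
  exists ([set nx | nx.1 = n], [set N | (n < N)%N]) => /=.
    split; last exact: nbhs_infty_gt.
    by apply/nbhs_nat_prod; exact: filterS filterT.
  by move=> [[m y] N] /= [->].
exists N => n Nn; apply: C0_norm_le => [|x]; first exact: ltW.
have [//|] := boolP (`|slice n z x| < e); first exact: ltW.
rewrite -norm_leNgt// => /(NP N (leqnn N) (n, x)).
by rewrite /= ltnNge Nn.
Qed.

Context (Q : C0 K L -> C0 K L) (bQ : bounded_linear Q).

Lemma isC0_coordinatewise (z : Z) :
  (fun nx => Q (slice nx.1 z) nx.2) \in @isC0 K (nat * L)%type.
Proof.
have [M M0 QM] := bounded_linear_bound bQ.
apply/isC0P; split.
  by apply: nat_prod_continuous => n; exact: (@C0_continuous _ _ (Q (slice n z))).
(* With slices of norm at most [e / 2 / (1 + M)] the operator [Q] produces norms below [e], so only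
   finitely many coordinates contribute to the superlevel set. *)
move=> e e0; have d0 : 0 < e / 2 / (1 + M) by rewrite !divr_gt0// ltr_pwDl.
have [N NP] := slice_small z d0.
have -> : [set nx | e <= `|Q (slice nx.1 z) nx.2|] =
    \big[setU/set0]_(n < N) ((fun x : L => (val n, x)) @`
      [set x | e <= `|Q (slice n z) x|]).
  rewrite -(bigcup_mkord N (fun n => (fun x : L => (n, x)) @`
      [set x | e <= `|Q (slice n z) x|])).
  apply/seteqP; split=> [[n x] /= ex|_ [n nN [x ex <-]]//].
  exists n => /=; last by exists x.
  rewrite ltnNge; apply/negP => /NP zn.
  suff : `|Q (slice n z) x| < e by move=> h; move: ex; rewrite lt_geF.
  apply: le_lt_trans (C0_le_norm _ _) _; apply: le_lt_trans (QM _) _.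
  apply: le_lt_trans (ler_wpM2l M0 zn) _.
  apply: (@le_lt_trans _ _ (e / 2)); last by rewrite gtr_pMr// invf_lt1// ltr1n.
  rewrite mulrCA ger_pMr ?divr_gt0// ler_pdivrMr ?ltr_pwDl// mul1r.
  by rewrite lerDr.
apply: bigsetU_compact => n _; apply: continuous_compact.
  by apply: continuous_subspaceT; exact: slice_continuous.
exact: compact_norm_ge.
Qed.

Definition coordinatewise (z : Z) : Z := MkC0 (isC0_coordinatewise z).

Lemma slice_coordinatewise n z : slice n (coordinatewise z) = Q (slice n z).
Proof. exact: C0_ext. Qed.

Lemma coordinatewise_bounded_linear : bounded_linear coordinatewise.
Proof.
have [M M0 QM] := bounded_linear_bound bQ; have [lQ _] := bQ.
split=> [a z w|]; first apply: C0_ext => -[n x] /=.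
  by have [-> _] := slice_bounded_linear n; rewrite lQ.
exists M => z; apply: C0_norm_le => [|[n x]]; first by rewrite mulr_ge0.
apply: le_trans (C0_le_norm (Q (slice n z)) x) _; apply: le_trans (QM _) _.
apply: ler_wpM2l => //; apply: C0_norm_le => // y; exact: (C0_le_norm z (n, y)).
Qed.

End coordinatewise.

Lemma slice_ext (L : topologicalType) (z w : C0 K (nat * L)%type) :
  (forall n, slice n z = slice n w) -> z = w.
Proof.
move=> zw; apply: C0_ext => -[n x].
by rewrite -[z _]/(slice n z x) zw.
Qed.

Lemma hausdorff_injection (T S : topologicalType) (f : T -> S) :
  continuous f -> injective f -> hausdorff_space S -> hausdorff_space T.
Proof.
move=> cf injf hS p q pq; apply/injf/hS => A B fpA fqB.
by have [x [Ax Bx]] := pq _ _ (cf p A fpA) (cf q B fqB); exists (f x).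
Qed.

Lemma hausdorff_prod (T S : topologicalType) :
  hausdorff_space T -> hausdorff_space S -> hausdorff_space (T * S)%type.
Proof.
move=> hT hS [p1 p2] [q1 q2] pq; congr pair; [apply: hT|apply: hS] => A B pA qB.
- have [||[x y] /= [Ax Bx]] := pq (fst @^-1` A) (fst @^-1` B); last by exists x.
    exact: (@cvg_fst _ _ (nbhs p1) (nbhs p2)).
  exact: (@cvg_fst _ _ (nbhs q1) (nbhs q2)).
- have [||[x y] /= [Ax Bx]] := pq (snd @^-1` A) (snd @^-1` B); last by exists y.
    exact: (@cvg_snd _ _ (nbhs p1) (nbhs p2)).
  exact: (@cvg_snd _ _ (nbhs q1) (nbhs q2)).
Qed.

(** * Shifts on the c_0-sum *)

Section shift.
Context (L : topologicalType) (hL : hausdorff_space L).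
Local Notation Z := (C0 K (nat * L)%type).

Let hZ : hausdorff_space (nat * L)%type.
Proof. by apply: hausdorff_prod => //; exact: discrete_hausdorff. Qed.

Let shift_continuous (g : nat -> nat) :
  continuous (fun nx : nat * L => (g nx.1, nx.2)).
Proof. by apply: nat_prod_continuous => n; exact: (@slice_continuous L (g n)). Qed.

Let succ_homeo : partial_homeo [set: nat * L] [set nx | nx.1 != 0%N]
  (fun nx => (nx.1.+1, nx.2)) (fun nx => (nx.1.-1, nx.2)).
Proof.
split=> //.
- rewrite openE => -[n x] /= n0; apply/nbhs_nat_prod.
  exact: filterS filterT.
- by move=> [n x].
- by move=> [[|n] x].
- move=> nx _; exact: (@shift_continuous S).
- move=> nx _; exact: (@shift_continuous predn).
Qed.

Let zero_homeo : partial_homeo [set: L] [set nx | nx.1 = 0%N]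
  (fun x => (0%N, x)) snd.
Proof.
split=> //.
- rewrite openE => -[n x] /= n0; apply/nbhs_nat_prod.
  exact: filterS filterT.
- by move=> [n x] /= ->.
- by move=> x _; exact: slice_continuous.
- by move=> [n x] _; exact: cvg_snd.
Qed.

Lemma left_shift_isC0 (z : Z) :
  (fun nx => z (nx.1.+1, nx.2)) \in @isC0 K (nat * L)%type.
Proof.
apply: (@isC0_closed_embedding _ _ _ (fun nx => (nx.1.-1, nx.2))).
- exact: (@shift_continuous S).
- exact: (@shift_continuous predn).
- by move=> [].
rewrite [X in closed X](_ : _ = ~` [set nx | nx.1 = 0%N]); last first.
  apply/seteqP; split=> [_ [nx _ <-]//|[[|n] x] //= _].
  by exists (n, x).
by apply: open_closedC; case: zero_homeo.
Qed.

Definition left_shift : Z -> Z := comp_op left_shift_isC0.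
Definition right_shift : Z -> Z := transfer succ_homeo hZ.
Definition zero_inclusion : C0 K L -> Z := transfer zero_homeo hZ.

Lemma slice_left_shift n z : slice n (left_shift z) = slice n.+1 z.
Proof. exact: C0_ext. Qed.

Lemma slice_right_shift n z :
  slice n (right_shift z) = if n is m.+1 then slice m z else 0.
Proof.
apply: C0_ext => x; rewrite -[LHS]/(right_shift z (n, x)) transferE.
  by case: n => [|n]; [rewrite asboolF//= => /eqP|rewrite asboolT].
by move=> y /(_ I).
Qed.

Lemma slice_zero_inclusion n f :
  slice n (zero_inclusion f) = if n is _.+1 then 0 else f.
Proof.
apply: C0_ext => x; rewrite -[LHS]/(zero_inclusion f (n, x)) transferE.
  by case: n => [|n]; [rewrite asboolT|rewrite asboolF].
by move=> y /(_ I).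
Qed.

Lemma left_shift_bounded_linear : bounded_linear left_shift.
Proof. exact: comp_op_bounded_linear. Qed.

Lemma right_shift_bounded_linear : bounded_linear right_shift.
Proof.
apply: transfer_comp_bounded_linear; first exact: bounded_linear_id.
by move=> v x /(_ I).
Qed.

Lemma zero_inclusion_bounded_linear : bounded_linear zero_inclusion.
Proof.
apply: transfer_comp_bounded_linear; first exact: bounded_linear_id.
by move=> v x /(_ I).
Qed.

End shift.

End C0_operators.

(** * Embedding into C_0(L_0) *)

Section embedding.
Context (K : numFieldType).

Lemma norm_small_eq0 (V : normedModType K) (a : V) (M : K) : 0 <= M ->
  (forall e, 0 < e -> `|a| <= M * e) -> a = 0.
Proof.
move=> M0 aM; apply/eqP; apply: contraT => a0.
have na : 0 < `|a| by rewrite normr_gt0.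
have M1 : 0 < 1 + M by rewrite ltr_pwDl.
have d0 : 0 < `|a| / 2 by rewrite divr_gt0.
suff : `|a| < `|a| by rewrite ltxx.
apply: le_lt_trans (aM (`|a| / 2 / (1 + M)) _) _; first by rewrite divr_gt0.
apply: (@le_lt_trans _ _ (`|a| / 2)); last by rewrite gtr_pMr// invf_lt1// ltr1n.
by rewrite mulrCA ger_pMr// ler_pdivrMr// mul1r lerDr.
Qed.

Lemma closure_norm (V : normedModType K) (A : set V) x :
  closure A x <-> forall e : K, 0 < e -> exists2 y, A y & `|x - y| < e.
Proof.
split=> [cx e e0|h B].
  have [|y [Ay xy]] := cx [set y | `|x - y| < e]; last by exists y.
  by apply/nbhs_normP; exists e.
move=> /nbhs_normP[e /= e0 eB]; have [y Ay xy] := h e e0.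
by exists y; split=> //; exact: eB.
Qed.

Lemma closed_fixed_points (V : normedModType K) (P : V -> V) :
  bounded_linear P -> closed [set f | P f = f].
Proof.
move=> bP; have [M M0 PM] := bounded_linear_bound bP.
move=> f /closure_norm cf; apply/eqP; rewrite -subr_eq0; apply/eqP.
apply: (@norm_small_eq0 _ _ (M + 1)); first by rewrite addr_ge0.
move=> e /cf[g /= Pg fg].
have -> : P f - f = P (f - g) - (f - g).
  by rewrite (bounded_linearB bP) Pg opprB addrA subrK.
apply: le_trans (ler_normB _ _) _.
rewrite mulrDl mul1r; apply: lerD; last exact: ltW.
by apply: le_trans (PM _) _; rewrite ler_wpM2l// ltW.
Qed.

Lemma fixed_points_linear (V : normedModType K) (P : V -> V) (a : K) f g :
  bounded_linear P -> P f = f -> P g = g -> P (a *: f + g) = a *: f + g.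
Proof. by move=> [lP _] Pf Pg; rewrite lP Pf Pg. Qed.

Context (L L' : topologicalType) (U : set L) (U' : set L').
Context (F : L -> L') (G : L' -> L) (FG : partial_homeo U U' F G).
Context (GF : partial_homeo U' U G F).
Context (hL : hausdorff_space L) (hL' : hausdorff_space L').
Local Notation T := (@transfer K _ _ _ _ _ _ FG hL').
Local Notation S := (@transfer K _ _ _ _ _ _ GF hL).

Let vanishing (M : topologicalType) (A : set M) :=
  [set f : C0 K M | forall x, ~ A x -> f x = 0].

Let vanishing_linear (M : topologicalType) (A : set M) (a : K) f g :
  vanishing A f -> vanishing A g -> vanishing A (a *: f + g).
Proof. by move=> f0 g0 x nAx; rewrite C0_addE C0_scaleE f0// g0// mulr0 addr0. Qed.

Lemma transferB (M M' : topologicalType) (A : set M) (A' : set M') F' G'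
    (FG' : partial_homeo A A' F' G') (hM' : hausdorff_space M') f g :
  vanishing A f -> vanishing A g ->
  @transfer K _ _ _ _ _ _ FG' hM' f - transfer FG' hM' g =
  transfer FG' hM' (f - g).
Proof.
move=> f0 g0; rewrite addrC -scaleN1r -transfer_linear_on//.
by rewrite scaleN1r addrC.
Qed.

Lemma embeds_transfer (Y : set (C0 K L)) :
  closed Y -> Y 0 -> (forall (a : K) f g, Y f -> Y g -> Y (a *: f + g)) ->
  Y `<=` vanishing U -> embeds (C0 K L') Y.
Proof.
move=> cY Y0 Ylin YU.
have vS g : vanishing U (S g) by move=> x; exact: transfer_off.
have vT f : vanishing U' (T f) by move=> x; exact: transfer_off.
have S0 : S 0 = 0.
  have v0 : vanishing U' (0 : C0 K L') by [].
  by rewrite -[in LHS](subrr 0) -transferB// subrr.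
(* This is the image of [Y] under [T], described through the inverse [S] so that closedness is
   inherited from [Y]. *)
exists [set g | vanishing U' g /\ Y (S g)]; split.
- move=> g /closure_norm cg.
  have vg : vanishing U' g.
    move=> y nUy; apply: (@norm_small_eq0 K^o _ 1) => // e /cg[h [vh _] gh].
    rewrite mul1r (le_trans _ (ltW gh))//.
    by rewrite -[g y]subr0 -(vh y nUy); exact: (C0_le_norm (g - h) y).
  split=> //; apply: cY; apply/closure_norm => e /cg[h [vh Yh] gh].
  exists (S h) => //; rewrite transferB//.
  exact: le_lt_trans (transfer_norm _ _ _) gh.
- split=> [|a f g /set_mem[vf Yf] /set_mem[vg Yg]]; apply/mem_set; split=> //=.
  + by rewrite S0.
  + exact: vanishing_linear.
  + by rewrite transfer_linear_on//; exact: Ylin.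
exists T, S; split.
- by move=> f Yf; split; [exact: vT|rewrite transferK//; exact: YU].
- by move=> g [].
- by move=> f /set_mem Yf; rewrite transferK//; exact: YU.
- by move=> g /set_mem[vg _]; rewrite transferK.
split.
- by move=> a f g Yf Yg; apply: transfer_linear_on; exact: YU.
- apply: (@lipschitz_continuous_within _ _ _ _ _ 1) => f g Yf Yg.
  rewrite mul1r transferB; [exact: transfer_norm|exact: YU|exact: YU].
- apply: (@lipschitz_continuous_within _ _ _ _ _ 1) => f g [vf _] [vg _].
  by rewrite mul1r transferB//; exact: transfer_norm.
Qed.

End embedding.

Section L0_embedding.
Context d (W : orderTopologicalType d) (W1 : is_omega1 W).
Context (D : set W) (cD : closed D) (th sg : W -> W).
Context (ths : enumerates D th sg).
Local Notation rho := (fun x => th (sg x)).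

Lemma nbhs_succ (a b : W) : is_succ a b -> nbhs b [set b].
Proof.
move=> [ab bmin]; apply/(nbhs_omega1 W1); split=> // z zb.
by exists a => // y /andP[/bmin by_ yb]; apply/le_anti; rewrite yb by_.
Qed.

Lemma L0_hausdorff : hausdorff_space (L0 W).
Proof.
apply: (@hausdorff_injection _ _ (@set_val _ (L0 W))).
- exact: initial_continuous.
- exact: val_inj.
- by apply: hausdorff_prod; exact: order_hausdorff.
Qed.

(* The interval of [W \ D] below [a] in [D] is sent to the block
   [0, a] * {a + 1} of [L0]. *)
Lemma L0_partial_homeo : exists U' F G,
  partial_homeo (~` D) U' (F : W -> L0 W) G.
Proof.
have /choice[sc scP] := exists_succ W1.
have inL0 x : L0 W (x, sc (rho x)).
  by exists (rho x) => //; split=> /=; [exact: (le_next ths)|exact: scP].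
pose F x : L0 W := exist _ (x, sc (rho x)) (mem_set (inL0 x)).
pose G (l : L0 W) := (set_val l).1.
(* The image of [F]. It is open because [rho] is locally constant off [D] and the second coordinate,
   being a successor, is isolated. *)
pose U' := [set l : L0 W | ~ D (set_val l).1 /\
  (set_val l).2 = sc (rho (set_val l).1)].
have cval : continuous (@set_val _ (L0 W)) by exact: initial_continuous.
have rho_near x : ~ D x -> nbhs x [set y | ~ D y /\ rho y = rho x].
  exact: (next_locally_constant W1 ths).
exists U', F, G; split.
- rewrite openE => l [nDl l2].
  have : nbhs (set_val l) ([set y | ~ D y /\ rho y = rho (set_val l).1] `*`
    [set (set_val l).2]).
    exists ([set y | ~ D y /\ rho y = rho (set_val l).1], [set (set_val l).2]) => //=.
    by split; [exact: rho_near|rewrite l2; apply: nbhs_succ (scP _)].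
  move=> /(cval l) h; apply: (@filterS _ (nbhs l) _ _ _ _ h).
  by move=> m /= [[nDm rm] m2]; split=> //; rewrite m2 l2 rm.
- by move=> x nDx; split.
- move=> l [nDl l2]; split=> //; apply: val_inj => /=.
  by rewrite /G -l2 -[RHS]/(set_val l); case: (set_val l).
- move=> x nDx A /= [_ [[V oV <-] /= Vx VA]].
  move: oV; rewrite openE => /(_ _ Vx) [[B C] /= [xB sC] BC].
  apply: filterS2 xB (rho_near x nDx) => y By [nDy ry].
  apply: VA => /=; apply: BC; split=> //=.
  by rewrite ry; exact: nbhs_singleton sC.
- move=> l _; apply: (@continuous_comp _ _ _ (@set_val _ (L0 W)) fst).
    exact: cval.
  exact: cvg_fst.
Qed.

End L0_embedding.

(** * Countably many copies of the complement of a club *)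

Section nat_copies.
Context d (W : orderTopologicalType d) (W1 : is_omega1 W).
Local Open Scope order_scope.

Lemma enumeration_gt (a : W) : exists th sg, enumerates [set x | a < x] th sg.
Proof.
apply: (enumeration W1); first exact: closed_gt.
move=> x; have [y xy] := exists_gt W1 (Order.max a x); exists y.
  by move: xy; rewrite gt_max => /andP[].
by move: xy; rewrite gt_max => /andP[].
Qed.

(* The interval of [W \ D] below [e] in [D] is copied into the disjoint
   intervals [J n e], each ending with the copy of [e]. *)
Lemma nat_copies (D : set W) (th sg : W -> W) : closed D ->
  (forall x, exists2 y, D y & x < y) -> enumerates D th sg ->
  exists (D' : set W) (F : nat * W -> W) G,
    [/\ closed D', forall x, exists2 y, D' y & x < y &
        partial_homeo [set nx : nat * W | ~ D nx.2] (~` D') F G].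
Proof.
move=> cD uD ths.
have rho_near x : ~ D x -> nbhs x [set y | ~ D y /\ th (sg y) = th (sg x)].
  exact: (next_locally_constant W1 ths).
(* [u a] is an increasing homeomorphism of [W] onto the tail above [a], with left inverse [s a]. *)
have /choice[us usP] a : exists us : (W -> W) * (W -> W),
    enumerates [set x | a < x] us.1 us.2.
  by have [u [s us]] := enumeration_gt a; exists (u, s).
pose u a := (us a).1; pose s a := (us a).2.
have {}usP a : enumerates [set x | a < x] (u a) (s a) by exact: usP.
have u_gt a x : a < u a x by have [h _ _ _ _] := usP a; exact: h.
have us_id a x : a < x -> u a (s a x) = x by have [_ h _ _ _] := usP a; exact: h.
have su_id a x : s a (u a x) = x by have [_ _ h _ _] := usP a; exact: h.
have uc a : continuous (u a) by have [_ _ _ _ []] := usP a.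
have sc a : continuous (s a) by have [_ _ _ _ []] := usP a.
have /choice[H HP] z : exists b, forall x y, x <= z -> y <= z -> u x y < b.
  have [|b bP] := countable_bounded W1
      (A := (fun xy => u xy.1 xy.2) @` ([set x | x <= z] `*` [set x | x <= z])).
    apply: (@sub_countable _ _ _ ([set x | x <= z] `*` [set x | x <= z])).
      exact: card_image_le.
    by apply: countableX; exact: countable_le.
  by exists b => x y xz yz; apply: bP; exists (x, y).
(* A point of [C] exceeds [u x y] for all smaller [x] and [y], so it stays above every block built
   from smaller points. *)
pose C := [set c | forall x, x < c -> H x < c].
have [al [be ab]] : exists al be, enumerates C al be.
  apply: (enumeration W1); first exact: closed_under_closed.
  by move=> x; have [c xc cC] := closed_under_unbounded W1 H x; exists c.
(* [E n.+1 x] is the copy of [x] in the tail above [E n x]; hence [(E n x, E n.+1 x]] is a copy of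
   [[0, x]]. By [E_cross] all these intervals for [x] lie below those for any larger point. *)
pose E n x := iter n (fun a => u a x) (al x).
have E_lt n x : E n x < E n.+1 x by exact: u_gt.
have E_le n m x : (n <= m)%N -> E n x <= E m x.
  elim: m => [|m ih]; first by rewrite leqn0 => /eqP->.
  by rewrite leq_eqVlt => /orP[/eqP->//|/ih h]; apply: le_trans h (ltW (E_lt _ _)).
have E_cross n x y : x < y -> E n x < al y.
  move=> xy; elim: n => [|n ih]; first by rewrite (enum_lt ab).
  have xal : x < al y by apply: le_lt_trans (le_enum W1 ab x) _; rewrite (enum_lt ab).
  have zy : Order.max (E n x) x < al y by rewrite gt_max ih xal.
  have [/(_ y) Cy _ _ _ _] := ab.
  by apply: lt_trans (Cy _ zy); apply: HP; rewrite le_max lexx ?orbT.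
pose J n x y := E n x < y <= E n.+1 x.
have J_lt n m x x' y : x < x' -> J n x y -> J m x' y -> False.
  move=> xx' /andP[_ h1] /andP[h2 _].
  have : y < y; last by rewrite ltxx.
  apply: le_lt_trans h1 _; apply: lt_trans (E_cross n.+1 _ _ xx') _.
  by apply: le_lt_trans h2; exact: (E_le 0%N).
have J_ltn n m x y : (n < m)%N -> J n x y -> J m x y -> False.
  move=> nm /andP[_ h1] /andP[h2 _].
  have : y < y; last by rewrite ltxx.
  by apply: le_lt_trans h1 _; apply: le_lt_trans h2; exact: E_le.
have J_uniq n m x x' y : J n x y -> J m x' y -> n = m /\ x = x'.
  move=> h1 h2; have [/J_lt h|/J_lt h|xx'] := ltgtP x x'.
  - by case: (h _ _ _ h1 h2).
  - by case: (h _ _ _ h2 h1).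
  - split=> //; move: h1 h2; rewrite xx'.
    by have [/J_ltn h1 /h1|/J_ltn h1 h2 /h1|] := ltngtP n m.
(* With [e] the next element of [D] after [x], the point [(n, x)] goes to the place of [x] in the
   copy [J n e] of [[0, e]]. *)
pose F (nx : nat * W) := u (E nx.1 (th (sg nx.2))) nx.2.
have /choice[k kP] y : exists k : nat * W, forall n x, J n x y -> k = (n, x).
  have [[[n x] nxy]|no] := pselect (exists k, J k.1 k.2 y).
    by exists (n, x) => m z /(J_uniq _ _ _ _ _ nxy) /= [-> ->].
  by exists (0%N, y) => n x h; exfalso; apply: no; exists (n, x).
pose G y : nat * W := ((k y).1, s (E (k y).1 (k y).2) y).
have GE n x y : J n x y -> G y = (n, s (E n x) y) by rewrite /G => /kP ->.
have J_nbhs n x y : J n x y -> nbhs y [set z | J n x z].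
  move=> /andP[h1 h2]; apply: open_nbhs_nbhs; split; last by rewrite /= /J h1.
  rewrite (_ : mkset _ = [set z | E n x < z] `&` [set z | z <= E n.+1 x]).
    by apply: openI; [exact: open_gt|exact: open_le].
  by apply/seteqP; split=> z /=; [move=> /andP[]|move=> [*]; apply/andP].
pose U' := [set y | exists n e, [/\ J n e y, ~ D (s (E n e) y) &
  th (sg (s (E n e) y)) = e]].
have oU' : open U'.
  rewrite openE => y [n [e [Jy nDy ye]]].
  have := sc (E n e) y _ (rho_near _ nDy); move: (J_nbhs _ _ _ Jy).
  apply: filterS2 => z Jz [nDz ze]; exists n, e; split=> //.
  by rewrite ze.
have JF n x : ~ D x -> J n (th (sg x)) (F (n, x)).
  move=> nDx; apply/andP; split; first exact: u_gt.
  by rewrite (enum_le (usP _)); exact: (le_next ths).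
exists (~` U'), F, G; split; first exact: open_closedC.
  (* The endpoint [E 1 e] of [J 0 e] is the copy of [e]; as [e] is in [D], it stays outside [U'].
     Such endpoints are unbounded. *)
  move=> x; have [e De xe] := uD x; exists (E 1%N e).
    move=> [m [e' [Je' nD _]]].
    have Je : J 0%N e (E 1%N e) by rewrite /J E_lt lexx.
    have [m0 ee] := J_uniq _ _ _ _ _ Je Je'; apply: nD.
    by rewrite -m0 -ee /= su_id.
  apply: lt_trans xe _; apply: le_lt_trans (le_enum W1 ab e) _.
  exact: (E_lt 0%N).
rewrite setCK; split=> //.
- move=> [n x] /= nDx; have Jx := JF n x nDx; split.
    by exists n, (th (sg x)); rewrite /F /= su_id; split.
  by rewrite (GE _ _ _ Jx) /F /= su_id.
- move=> y [n [e [Jy nDy ye]]]; rewrite (GE _ _ _ Jy) /F /= ye; split=> //.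
  by apply: us_id; case/andP: Jy.
- move=> [n x] /= nDx A FA; apply/nbhs_nat_prod.
  have := uc (E n (th (sg x))) x _ FA; move: (rho_near x nDx).
  by apply: filterS2 => y [_ yx]; rewrite /F /= yx.
- move=> y [n [e [Jy nDy ye]]] A; rewrite (GE _ _ _ Jy) => /nbhs_nat_prod GA.
  have := sc (E n e) y _ GA; move: (J_nbhs _ _ _ Jy).
  by apply: filterS2 => z Jz; rewrite /= (GE _ _ _ Jz).
Qed.

End nat_copies.

(** * Projections whose range vanishes on a club *)

Section club_vanishing.
Context (K : numFieldType) (d : Order.disp_t) (W : orderTopologicalType d).
Context (W1 : is_omega1 W).
Local Notation X := (C0 K W).

Section enumeration_operators.
Context (D : set W) (cD : closed D) (th sg : W -> W) (ths : enumerates D th sg).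

Lemma enum_isC0 (f : X) : (fun x => f (th x)) \in @isC0 K W.
Proof.
have [thD thsg sgth _ [cth csg]] := ths.
apply: (@isC0_closed_embedding _ _ _ _ sg) => //.
rewrite (_ : range th = D)//; apply/seteqP; split=> [_ [x _ <-]//|x Dx].
by exists (sg x) => //; exact: thsg.
Qed.

Lemma enum_inv_isC0 (f : X) : (fun x => f (sg x)) \in @isC0 K W.
Proof.
have [_ _ _ galois [_ csg]] := ths.
have cfs : continuous (fun x => f (sg x)).
  by move=> x; apply: continuous_comp; [exact: csg|exact: C0_continuous].
apply/isC0P; split=> // e e0.
have [b bP] := compact_bounded_above W1 (@compact_norm_ge _ _ f e e0).
apply: (subclosed_compact _ (@compact_le _ _ W1 (th b))); first exact: closed_norm_ge.
by move=> x /= /bP; rewrite galois.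
Qed.

Definition enum_op : X -> X := comp_op enum_isC0.
Definition enum_inv_op : X -> X := comp_op enum_inv_isC0.

Lemma enum_opK f : enum_op (enum_inv_op f) = f.
Proof. by apply: C0_ext => x /=; have [_ _ -> _ _] := ths. Qed.

Lemma enum_op_eq0 (f : X) : (forall x, D x -> f x = 0) -> enum_op f = 0.
Proof. by move=> f0; apply: C0_ext => x /=; apply: f0; have [] := ths. Qed.

Lemma enum_op_sub_vanishes (f : X) x : D x -> (f - enum_inv_op (enum_op f)) x = 0.
Proof.
by move=> Dx; have [_ thsg _ _ _] := ths; rewrite C0_subE /= thsg// subrr.
Qed.

End enumeration_operators.

(** The range is moved into [L0 W] by extension by zero. For the kernel the swindle is applied with
    the c_0-sum [C0 K (nat * W)] as [Z]. *)
Lemma club_vanishing (P : X -> X) (D : set W) :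
  bounded_linear P -> (forall f, P (P f) = P f) ->
  closed D -> (forall x, exists2 y, D y & (x < y)%O) ->
  (forall f x, D x -> P f x = 0) ->
  isomorphic [set f | P f = 0] [set: X] /\
  embeds (C0 K (L0 W)) [set f | P f = f].
Proof.
move=> bP PP cD uD PD; have oD := closed_openC cD.
have [th [sg ths]] := enumeration W1 cD uD.
have hW : hausdorff_space W by exact: order_hausdorff.
split; last first.
  have [U' [F [G FG]]] := L0_partial_homeo W1 cD ths.
  apply: (embeds_transfer FG (partial_homeo_sym oD FG) hW (@L0_hausdorff _ W)).
  - exact: closed_fixed_points.
  - exact: bounded_linear0.
  - by move=> a f g; exact: fixed_points_linear.
  - by move=> f /= Pf x /contrapT Dx; rewrite -Pf PD.
have [D' [F [G [cD' uD' FG]]]] := nat_copies W1 cD uD ths.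
have [th' [sg' ths']] := enumeration W1 cD' uD'.
have oU : open [set nx : nat * W | ~ D nx.2].
  rewrite openE => -[n x] /= nDx; apply/nbhs_nat_prod.
  by apply: open_nbhs_nbhs; split.
have GF := partial_homeo_sym oU FG.
have hZ : hausdorff_space (nat * W)%type.
  by apply: hausdorff_prod => //; exact: discrete_hausdorff.
(* [t] restricts a function to [D], re-indexed by [W]; [r] extends back, constantly between
   consecutive elements of [D]. *)
pose t := enum_op cD ths; pose r := enum_inv_op ths.
have bt : bounded_linear t by exact: comp_op_bounded_linear.
have br : bounded_linear r by exact: comp_op_bounded_linear.
have tr f : t (r f) = f by exact: enum_opK.
have tP f : t (P f) = 0 by apply: enum_op_eq0 => x; exact: PD.
pose q f := f - r (t f) - P (f - r (t f)).
have [bq tq Pq [qq qr qP]] :=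
  projection_facts bP bt br (fun f => erefl (q f)) PP tr tP.
have qD f x : D x -> q f x = 0.
  by move=> Dx; rewrite C0_subE enum_op_sub_vanishes// PD// subrr.
pose qZ := coordinatewise bq.
have bqZ : bounded_linear qZ by exact: coordinatewise_bounded_linear.
have qqZ z : qZ (qZ z) = qZ z.
  by apply: slice_ext => n; rewrite !slice_coordinatewise.
have qZD z nx : ~ ~ D nx.2 -> qZ z nx = 0 by move=> /contrapT; exact: qD.
pose e' f := f - enum_inv_op ths' (enum_op cD' ths' f).
have be' : bounded_linear e'.
  apply: bounded_linear_sub; first exact: bounded_linear_id.
  by apply: bounded_linear_comp; exact: comp_op_bounded_linear.
have e'D f x : ~ ~ D' x -> e' f x = 0.
  by move=> /contrapT Dx; exact: enum_op_sub_vanishes.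
(* [e'] projects onto the functions vanishing on [D'], which are spread over the copies of the
   complement of [D] and then cut down by [q] in each coordinate. [B] goes back; its values vanish
   on [D'], so [e'] fixes them. *)
pose A f := qZ (transfer GF hZ (e' f)).
pose B z : X := transfer FG hW (qZ z).
have bA : bounded_linear A.
  apply: bounded_linear_comp bqZ.
  exact: (transfer_comp_bounded_linear _ _ be' e'D).
have bB : bounded_linear B.
  exact: (transfer_comp_bounded_linear _ _ bqZ qZD).
have AB z : qZ z = z -> A (B z) = z.
  move=> qz; rewrite /A /B /e' (@enum_op_eq0 _ cD' _ _ ths').
    have -> : enum_inv_op ths' 0 = 0 by apply: C0_ext.
    by rewrite subr0 qz transferK// => nx; rewrite -qz; exact: qZD.
  by move=> x D'x; apply: transfer_off => /(_ D'x).
have b0 := bounded_linear0 bq.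
apply: (@eilenberg_swindle K X (C0 K (nat * W)%type) P t r q A B qZ
  (right_shift hW) (@left_shift K W) (zero_inclusion hW) (slice 0)) => //.
- exact: right_shift_bounded_linear.
- exact: left_shift_bounded_linear.
- exact: zero_inclusion_bounded_linear.
- exact: slice_bounded_linear.
- by move=> f; rewrite /A qqZ.
- move=> z; apply: slice_ext => -[|n].
    by rewrite slice_coordinatewise !slice_right_shift b0.
  by rewrite slice_coordinatewise !slice_right_shift slice_coordinatewise.
- by move=> z; apply: slice_ext => n;
    rewrite slice_coordinatewise !slice_left_shift slice_coordinatewise.
- move=> f; apply: slice_ext => -[|n].
    by rewrite slice_coordinatewise !slice_zero_inclusion.
  by rewrite slice_coordinatewise !slice_zero_inclusion b0.
- by move=> z; exact: slice_coordinatewise.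
- by move=> z; apply: slice_ext => n; rewrite slice_left_shift slice_right_shift.
- by move=> z; rewrite slice_right_shift.
- move=> f; apply: slice_ext => n; rewrite slice_left_shift slice_zero_inclusion.
  exact: C0_ext.
- by move=> f; rewrite slice_zero_inclusion.
- move=> z; apply: slice_ext => n.
  rewrite (bounded_linearD (slice_bounded_linear _ _ n)).
  rewrite slice_zero_inclusion slice_right_shift.
  by case: n => [|n]; rewrite ?addr0// slice_left_shift add0r.
Qed.

End club_vanishing.

(** * Diagonality of projections on a club *)

Section diagonal.
Context (K : numFieldType) (arch : forall x : K, exists n, `|x| < n%:R).
Context (d : Order.disp_t) (W : orderTopologicalType d) (W1 : is_omega1 W).
Local Notation X := (C0 K W).

Lemma arch_inv (e : K) : 0 < e -> exists n, n.+1%:R^-1 < e.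
Proof.
move=> e0; have [n en] := arch e^-1; exists n.
rewrite -[e]invrK ltf_pV2 ?posrE ?invr_gt0//.
rewrite gtr0_norm ?invr_gt0// in en.
by rewrite (lt_trans en)// ltr_nat.
Qed.

(** Each set where [|f x| >= 1 / n.+1] is compact, hence bounded, and countably many bounds have a
    common bound. *)
Lemma C0_support (f : X) : exists b, forall x, (b < x)%O -> f x = 0.
Proof.
have /choice[B BP] n : exists b, forall x, n.+1%:R^-1 <= `|f x| -> (x <= b)%O.
  by apply: (compact_bounded_above W1); apply: compact_norm_ge; rewrite invr_gt0.
have [b bP] := seq_bounded W1 B.
exists b => x bx; apply: (@norm_small_eq0 K K^o _ 1) => // e /arch_inv[n ne].
rewrite mul1r; apply: le_trans (ltW ne).
have [/ltW//|] := boolP (`|f x| < n.+1%:R^-1).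
rewrite -norm_leNgt ?invr_gt0// => /BP xb.
by have := lt_trans (le_lt_trans xb (bP n)) bx; rewrite ltxx.
Qed.

Lemma near_constant_continuous (T : topologicalType) (f : T -> K^o) (x : T) :
  (\forall y \near x, f y = f x) -> {for x, continuous f}.
Proof. by move=> fx A fA; apply: filterS fx => y /= ->; exact: nbhs_singleton. Qed.

Lemma chi_isC0 (g : W) : (fun x => (x <= g)%O%:R : K^o) \in @isC0 K W.
Proof.
have c : continuous (fun x => (x <= g)%O%:R : K^o).
  move=> x; apply: near_constant_continuous; have [xg|gx] := leP x g.
    by apply: filterS (open_nbhs_nbhs (conj (open_le W1 g) xg)) => y /= ->.
  apply: filterS (open_nbhs_nbhs (conj (open_gt g) gx)) => y /=.
  by rewrite ltNge => /negbTE ->.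
apply/isC0P; split=> // e e0.
apply: (subclosed_compact _ (@compact_le _ _ W1 g)); first exact: closed_norm_ge.
by move=> x /=; case: leP => // _; rewrite normr0 lt_geF.
Qed.

Definition chi g : X := MkC0 (chi_isC0 g).

(** The span of the [chi g] is dense. By induction on [b], [f] is approximated on [[0, b]]: it is
    within [e] of [f b] on some [(a, b]], so [f b] times the indicator [chi b - chi a] is added to
    an approximant on [[0, a]]. *)
Lemma functional_ext (mu : X -> K^o) : bounded_linear mu ->
  (forall g, mu (chi g) = 0) -> forall f, mu f = 0.
Proof.
move=> bmu mu0 f; have [M M0 muM] := bounded_linear_bound bmu.
have step (e : K) b : 0 < e -> exists h : X, [/\ mu h = 0,
    forall x, (x <= b)%O -> `|f x - h x| <= e &
    forall x, (b < x)%O -> h x = 0].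
  move=> e0; elim/(omega1_ind W1): b => b ih.
  have [[z zb]|nz] := pselect (exists z, (z < b)%O); last first.
    exists (f b *: chi b); split.
    - have [lmu _] := bmu; rewrite -[_ *: _]addr0 lmu mu0.
      by rewrite (bounded_linear0 bmu) scaler0 addr0.
    - move=> x xb; suff -> : x = b.
        by rewrite C0_scaleE /= lexx mulr1 subrr normr0 ltW.
      apply: contrapT => /eqP ne; apply: nz; exists x.
      by rewrite lt_neqAle ne.
    - by move=> x bx; rewrite C0_scaleE /= leNgt bx /= mulr0.
  have /cvgrPdist_lt/(_ e e0) := @C0_continuous _ _ f b.
  move=> /(nbhs_omega1 W1)[_ /(_ z zb)[a ab aP]].
  have [h [mh hf h0]] := ih a ab.
  exists (f b *: (chi b - chi a) + h); split.
  - have [lmu _] := bmu; rewrite lmu mh addr0 (bounded_linearB bmu) !mu0.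
    by rewrite subrr scaler0.
  - move=> x xb; rewrite C0_addE C0_scaleE C0_subE /= xb.
    have [xa|ax] := leP x a; first by rewrite subrr mulr0 add0r; exact: hf.
    rewrite subr0 mulr1 h0// addr0 distrC ltW//; apply: aP.
    by rewrite ax xb.
  - move=> x bx; rewrite C0_addE C0_scaleE C0_subE /= h0 ?(lt_trans ab)//.
    by rewrite !leNgt bx (lt_trans ab bx) subrr mulr0 addr0.
have [b fb] := C0_support f.
apply: (norm_small_eq0 M0) => e e0; have [h [mh hf h0]] := step e b e0.
rewrite -[mu f]subr0 -mh -(bounded_linearB bmu); apply: le_trans (muM _) _.
apply: ler_wpM2l => //; apply: C0_norm_le => [|x]; first exact: ltW.
rewrite C0_subE; have [/hf//|bx] := leP x b.
by rewrite fb// h0// subrr normr0 ltW.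
Qed.

(* Otherwise there would be arbitrarily many disjoint clopen intervals on
   whose indicator functions [mu] is bounded away from 0. *)
Lemma functional_eventually_constant (mu : X -> K^o) : bounded_linear mu ->
  exists g, forall h, (g <= h)%O -> mu (chi h) = mu (chi g).
Proof.
move=> bmu; have [M M0 muM] := bounded_linear_bound bmu.
have [lmu _] := bmu.
have /choice[B BP] n : exists g, forall h, (g <= h)%O ->
    `|mu (chi h) - mu (chi g)| < n.+1%:R^-1.
  apply: contrapT => no; set e : K := n.+1%:R^-1 in no.
  have e0 : 0 < e by rewrite invr_gt0.
  have {}no g : exists2 h, (g <= h)%O & e <= `|mu (chi h) - mu (chi g)|.
    apply: contrapT => no'; apply: no; exists g => h gh.
    apply: contrapT => /negP; rewrite -norm_leNgt// => eh.
    by apply: no'; exists h.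
  have build N g : exists f : X, [/\ forall x, (x <= g)%O -> f x = 0,
      forall x, `|f x| <= 1 & N%:R * e <= mu f].
    elim: N g => [|N ih] g.
      exists 0; split=> // [x|]; first by rewrite normr0.
      by rewrite mul0r (bounded_linear0 bmu).
    have [h gh eh] := no g; have [f [f0 f1 fN]] := ih h.
    set D := mu (chi h) - mu (chi g) in eh.
    have D0 : `|D| != 0 by rewrite gt_eqF// (lt_le_trans e0).
    have D0' : D != 0 by rewrite -normr_eq0.
    (* The unimodular factor turns the value [D] of [mu] into [|D| >= e], so the contributions of
       the disjoint intervals add up while the norm stays at most 1. *)
    exists ((`|D| / D) *: (chi h - chi g) + f); split.
    - move=> x xg; rewrite C0_addE C0_scaleE C0_subE /= xg (le_trans xg gh).
      by rewrite subrr mulr0 add0r f0// (le_trans xg).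
    - move=> x; rewrite C0_addE C0_scaleE C0_subE /=.
      have [xh|hx] := leP x h.
        rewrite f0// addr0 normrM normrM normfV normr_id divff// mul1r.
        by case: (x <= g)%O; rewrite ?subrr ?subr0 ?normr0 ?normr1.
      by rewrite leNgt (le_lt_trans gh hx) subrr mulr0 add0r.
    - rewrite lmu (bounded_linearB bmu) -/D.
      rewrite -[(_ / _) *: D]/(_ / _ * D) divfK//.
      by rewrite -natr1 mulrDl mul1r addrC lerD.
  have [w _] := omega1_inhabited W1.
  (* With more than [M / e] intervals, [mu f] would exceed [M]. *)
  have [N NM] := arch (M / e).
  have [f [_ f1 fN]] := build N w.
  suff : M < M by rewrite ltxx.
  apply: (@lt_le_trans _ _ (N%:R * e)).
    by rewrite -ltr_pdivrMr// (le_lt_trans _ NM)// ger0_norm// divr_ge0// ltW.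
  have mu0 : 0 <= mu f by apply: le_trans fN; rewrite mulr_ge0// ltW.
  apply: le_trans fN _; rewrite -(ger0_norm mu0); apply: le_trans (muM f) _.
  by rewrite ler_piMr//; exact: C0_norm_le.
have [g gP] := seq_bounded W1 B; exists g => h gh.
apply/eqP; rewrite -subr_eq0; apply/eqP.
apply: (@norm_small_eq0 K K^o _ 2) => // e /arch_inv[n ne].
have Bg : (B n <= g)%O := ltW (gP n).
rewrite -(subrKA (mu (chi (B n)))) mulr_natl mulr2n.
apply: le_trans (ler_normD _ _) _; apply: lerD; apply/ltW/(lt_trans _ ne).
  exact: (BP n h (le_trans Bg gh)).
by rewrite distrC; exact: BP.
Qed.

Lemma C0_limit (f : X) (v : K) (c z : W) : (z < c)%O ->
  (forall a, (a < c)%O -> exists2 y, (a < y <= c)%O & f y = v) -> f c = v.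
Proof.
move=> zc h; apply: (@closed_limit _ _ W1 [set y | f y = v] c z) => //.
rewrite (_ : mkset _ = f @^-1` [set v])//; apply: closed_comp.
  by move=> x _; exact: C0_continuous.
by apply: accessible_closed_set1; apply: hausdorff_accessible; exact: norm_hausdorff.
Qed.

Lemma diagonal_on_club (P : X -> X) : bounded_linear P ->
  (forall f, P (P f) = P f) -> exists D : set W,
    [/\ closed D, forall x, exists2 y, D y & (x < y)%O &
        (forall f x, D x -> P f x = 0) \/ (forall f x, D x -> P f x = f x)].
Proof.
move=> bP PP.
have bPx x : bounded_linear (fun f => P f x : K^o).
  apply: (bounded_linear_comp bP (g := fun f : X => f x : K^o)); split=> //.
  by exists 1 => f; rewrite mul1r; exact: C0_le_norm.
have /choice[be beP] g : exists b, forall x, (b < x)%O -> P (chi g) x = 0.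
  exact: C0_support.
have /choice[ga gaP] x : exists g, forall h, (g <= h)%O ->
    P (chi h) x = P (chi g) x.
  exact: (functional_eventually_constant (bPx x)).
have /choice[sc scP] := exists_gt W1.
(* Closure under [sc] makes points of [C] limits, closure under [be] puts the support of [P (chi g)]
   below them for smaller [g], and closure under [ga] stabilises [P (chi h) x] before them. *)
pose H x := Order.max (sc x) (Order.max (be x) (ga x)).
pose C := [set c | forall x, (x < c)%O -> (H x < c)%O].
have CP c x : C c -> (x < c)%O -> [/\ (sc x < c)%O, (be x < c)%O & (ga x < c)%O].
  by move=> Cc /Cc; rewrite !gt_max => /andP[-> /andP[-> ->]].
have diag c z f : C c -> (z < c)%O -> P f c = P (chi c) c * f c.
  move=> Cc zc; set l := P (chi c) c; apply/eqP; rewrite -subr_eq0; apply/eqP.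
  apply: (@functional_ext (fun f => P f c - l * f c)) => [|g].
    apply: bounded_linear_sub; first exact: bPx.
    split=> [a u v|]; first by rewrite C0_addE C0_scaleE mulrDr mulrCA.
    by exists `|l| => u; rewrite normrM ler_wpM2l//; exact: C0_le_norm.
  have [cg|gc] := leP c g; last first.
    have [_ bc _] := CP c g Cc gc.
    by rewrite beP//= leNgt gc mulr0 subrr.
  (* For [c <= g] the functions [P (chi g)] and [P (chi c)] agree at points accumulating at [c] from
     the left, hence at [c]. *)
  rewrite /= cg mulr1; apply: (@C0_limit (P (chi g) - P (chi c)) 0 c z) => // a ac.
  have [sa _ _] := CP c a Cc ac.
  have [_ _ gs] := CP c _ Cc sa.
  exists (sc a); first by rewrite scP ltW.
  by rewrite C0_subE gaP ?(gaP _ c) ?subrr// ?(le_trans (ltW gs))// ltW.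
have unb (A : set W) : ~ (exists b, forall x, A x -> (x <= b)%O) ->
    forall x, exists y, A y /\ (x < y)%O.
  move=> nb x; apply: contrapT => no; apply: nb; exists x => y Ay.
  by rewrite leNgt; apply/negP => xy; apply: no; exists y.
have [w _] := omega1_inhabited W1.
(* The points of [C] with diagonal entry [v]. Evaluating [P (P (chi c)) = P (chi c)] at [c] shows
   that the entry is idempotent, so 0 or 1. *)
pose A (v : K) := [set c | [/\ C c, (w < c)%O & P (chi c) c = v]].
have A01 c : C c -> (w < c)%O -> A 0 c \/ A 1 c.
  move=> Cc wc; have := diag c w (P (chi c)) Cc wc; rewrite PP.
  set l := P (chi c) c => ll.
  have [l0|l0] := eqVneq l 0; first by left.
  right; split=> //; rewrite -/l; apply: (mulfI l0).
  by rewrite mulr1 -ll.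
have chiE c c' : C c -> (w < c)%O -> (c <= c')%O -> P (chi c') c = P (chi c) c.
  by move=> Cc wc cc'; rewrite (diag c w)//= cc' mulr1.
have bdd : (exists b, forall x, A 0 x -> (x <= b)%O) \/
           (exists b, forall x, A 1 x -> (x <= b)%O).
  have [|/unb/choice[H0 H0P]] := pselect (exists b, forall x, A 0 x -> (x <= b)%O).
    by left.
  have [|/unb/choice[H1 H1P]] := pselect (exists b, forall x, A 1 x -> (x <= b)%O).
    by right.
  (* If both values occurred unboundedly often, some [c] would be a limit of points of both kinds.
     By [chiE] the continuous function [P (chi c)] takes those entries there, so its value at [c]
     would be both 0 and 1. *)
  exfalso; have [c wc cP] := closed_under_unbounded W1
    (fun x => Order.max (H0 x) (H1 x)) w.
  have lim v (Hv : W -> W) : (forall x, A v (Hv x) /\ (x < Hv x)%O) ->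
      (forall x, (x < c)%O -> (Hv x < c)%O) -> P (chi c) c = v.
    move=> HvP Hc; apply: (C0_limit wc) => a ac.
    have [[CH wH <-] aH] := HvP a; exists (Hv a); first by rewrite aH ltW// Hc.
    by apply: chiE => //; rewrite ltW// Hc.
  have : 0 = 1 :> K.
    rewrite -(lim 0 H0)// => [|x /cP]; last by rewrite gt_max => /andP[].
    by apply: (lim 1 H1) => // x /cP; rewrite gt_max => /andP[].
  by apply/eqP; rewrite eq_sym oner_eq0.
have club b : closed (C `&` [set x | (Order.max b w < x)%O]) /\
    forall x, exists2 y, (C `&` [set x | (Order.max b w < x)%O]) y & (x < y)%O.
  split; first by apply: closedI; [exact: closed_under_closed|exact: closed_gt].
  move=> x; have [c xc Cc] := closed_under_unbounded W1 H (Order.max x (Order.max b w)).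
  by exists c; move: xc; rewrite gt_max => /andP[].
case: bdd => -[b bA]; have [cD uD] := club b;
  exists (C `&` [set x | (Order.max b w < x)%O]); split=> //.
- right => f x [Cx]; rewrite /= gt_max => /andP[bx wx].
  have [/bA|[_ _ l1]] := A01 x Cx wx; first by rewrite leNgt bx.
  by rewrite (diag x w)// l1 mul1r.
- left => f x [Cx]; rewrite /= gt_max => /andP[bx wx].
  have [[_ _ l0]|/bA] := A01 x Cx wx; last by rewrite leNgt bx.
  by rewrite (diag x w)// l0 mul0r.
Qed.

End diagonal.

(** * Conclusion for real and complex scalars *)

Lemma archimedean_real_or_complex (R : realType) (K : numFieldType) :
  K = R :> numFieldType \/ K = R[i] :> numFieldType ->
  forall x : K, exists n, `|x| < n%:R.
Proof.
case=> -> x.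
  by exists (Num.bound `|x|); exact: archi_boundP.
rewrite normc_def; set r := Num.sqrt _; exists (Num.bound r).
rewrite -(rmorph_nat (real_complex R)) ltcR; apply: archi_boundP.
exact: sqrtr_ge0.
Qed.

Theorem corollary1p9 (R : realType) (K : numFieldType)
    (K_real_or_complex : K = R :> numFieldType \/ K = R[i] :> numFieldType)
    (d : Order.disp_t) (W : orderTopologicalType d) (W_omega1 : is_omega1 W)
    (P : {linear C0 K W -> C0 K W})
    (P_bounded : exists M : K, forall f, `|P f| <= M * `|f|)
    (P_projection : forall f, P (P f) = P f) :
  (isomorphic [set f | P f = 0] [set: C0 K W] /\ embeds (C0 K (L0 W)) (range P)) \/
  (isomorphic (range P) [set: C0 K W] /\ embeds (C0 K (L0 W)) [set f | P f = 0]).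
Proof.
have arch := archimedean_real_or_complex K_real_or_complex.
have bP : bounded_linear P by split=> // a f g; rewrite linearP.
have rangeE : range P = [set f | P f = f].
  by apply/seteqP; split=> [_ [f _ <-] /=|f /= Pf]; [|exists f].
have [D [cD uD [PD|PD]]] := diagonal_on_club arch W_omega1 bP P_projection.
  by left; rewrite rangeE; exact: (club_vanishing W_omega1 bP _ cD uD PD).
(* Here [P] is the identity on [D], so [1 - P] vanishes there; passing to it exchanges kernel and
   range. *)
right; pose Q f := f - P f.
have bQ : bounded_linear Q by apply: bounded_linear_sub => //; exact: bounded_linear_id.
have QQ f : Q (Q f) = Q f.
  by rewrite {1}/Q /Q linearB P_projection subrr subr0.
have QD f x : D x -> Q f x = 0 by move=> Dx; rewrite C0_subE PD// subrr.
have [iso emb] := club_vanishing W_omega1 bQ QQ cD uD QD.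
have -> : range P = [set f | Q f = 0].
  rewrite rangeE; apply/seteqP; split=> f /=; rewrite /Q.
    by move=> ->; rewrite subrr.
  by move=> /eqP; rewrite subr_eq0 => /eqP.
have -> : [set f | P f = 0] = [set f | Q f = f].
  apply/seteqP; split=> f /=; rewrite /Q; first by move=> ->; rewrite subr0.
  by move=> /eqP; rewrite -subr_eq0 addrAC subrr sub0r oppr_eq0 => /eqP.
by [].
Qed.
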